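(* Let $k$ be a field, $p(x)=x^2-\alpha x+\beta\in k[x]$, $q(x)=x^2+\alpha x+\beta$, and $n\ge1$. Let $R=k^n\otimes_{(f,\delta)}k[x]/(p(x))$ be the twisted tensor product given by a twisting map $(f,\delta)$ whose associated colored quiver $Q=Q_f$ is connected. Then (all roots being roots in $k$): (a) If $Q$ is a strict $2$-cycle: (i) if $Q$ is colored by roots of $q$, then $R\cong kQ_{<2}$; (ii) otherwise $R\cong\mathcal{M}_2(k)$. (b) If $Q$ is a $1$-cycle: (i) if $p$ has no root, then $n=1$ and therefore $R\cong k[x]/(p(x))$; (ii) if $p$ has a single root, then $R\cong k(Q^{\mathrm{op}})_{<2}$; (iii) if $p$ has two different roots, then $R\cong k\big((\widehat{Q})^{\mathrm{op}}\big)_{<2}$. (c) Otherwise, $R\cong k(Q^{\mathrm{op}})_{<2}$. Here $\cong$ denotes isomorphism of $k$-algebras.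
   Context: Algebras are unital associative $k$-algebras, maps are $k$-linear, $\otimes=\otimes_k$. For algebras $A,B$ a twisting map is a linear map $\tau:B\otimes A\to A\otimes B$ with $\tau\circ(B\otimes\mu_A)=(\mu_A\otimes B)\circ(A\otimes\tau)\circ(\tau\otimes A)$, $\tau\circ(\mu_B\otimes A)=(A\otimes\mu_B)\circ(\tau\otimes B)\circ(B\otimes\tau)$, $\tau(1\otimes a)=a\otimes1$, $\tau(b\otimes1)=1\otimes b$; $A\otimes_\tau B$ is $A\otimes B$ with product $(\mu_A\otimes\mu_B)\circ(A\otimes\tau\otimes B)$. A twisting map $\tau:k[x]/(p(x))\otimes A\to A\otimes k[x]/(p(x))$ is identified with the pair $(f,\delta)$ such that $\tau(x\otimes a)=\delta(a)\otimes1+f(a)\otimes x$ ($f$ an algebra endomorphism of $A$, $\delta$ a left $f$-derivation with $\delta^2-\alpha\delta+\beta\,\mathrm{id}=\beta f^2$, $f\delta+\delta f=\alpha(f-f^2)$), and one writes $A\otimes_{(f,\delta)}k[x]/(p(x))$. For $A=k^n$ with canonical basis $e_1,\dots,e_n$: each algebra endomorphism is $f(e_i)=\sum_{\varphi(e_j)=e_i}e_j$ for a unique self-map $\varphi$ of $\{e_1,\dots,e_n\}$; $Q_f$ is the quiver with vertices $e_i$ and one arrow $e_i\to\varphi(e_i)$ for each $i$; loop vertices are the $e_i$ with $\varphi(e_i)=e_i$. Each $f$-derivation is $\delta(e_i)=\sum_{\varphi(e_j)=e_i}a_je_j-a_ie_i$ for a unique $a\in k^n$ with $a_i=0$ at loop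 vertices (the coloration; $a_i$ is the color of $e_i$). A connected $Q_f$ contains exactly one oriented cycle, with trees oriented towards it; it is an $s$-cycle if that cycle has $s$ vertices, and a strict $s$-cycle if it consists only of that cycle (a strict $2$-cycle is the round-trip quiver with two vertices and one arrow in each direction). For a quiver $Q$, $kQ$ is the path algebra, with arrows multiplied as maps (the path $\alpha$ followed by $\beta$ is $\beta\alpha$); $Q^{\mathrm{op}}$ is the quiver with all arrows reversed; $kQ_{<2}:=kQ/(Q_{\ge2})$, where $(Q_{\ge2})$ is the ideal generated by all paths of length greater than one. The quiver $\widehat Q$ is defined for a colored $1$-cycle $Q$ when $q$ has two distinct roots $r_1,r_2\in k$ (in this case every non-loop vertex is colored by $r_1$ or $r_2$): remove the loop vertex and all arrows ending at it, obtaining finitely many trees (whose root nodes are the immediate predecessors of the loop vertex other than itself); insert two new isolated vertices $1$ and $2$; for each tree insert an arrow from its root node to $1$ if the root node is colored by $r_1$, or to $2$ if it is colored by $r_2$. *)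

(* Defs.v *)
From HB Require Import structures.
From mathcomp Require Import all_boot all_order all_algebra all_field.
From mathcomp Require Import finmap monalg boolp.

Set Implicit Arguments.
Unset Strict Implicit.
Unset Printing Implicit Defensive.

Import GRing.Theory.
Import VectorInternalTheory.

Local Open Scope ring_scope.

(* The tensor product over k of two finite-dimensional spaces, by coordinates
   in the bases given by their vectType structures; its universal property is
   tlift_linear, tlift_tens and tensor_sum below. *)
Definition tensor (k : fieldType) (U V : vectType k) : Type :=
  'M[k]_(dim U, dim V).

HB.instance Definition _ (k : fieldType) (U V : vectType k) :=
  Vector.on (tensor U V).

Definition tens (k : fieldType) (U V : vectType k) (u : U) (v : V) :
  tensor U V := (v2r u)^T *m v2r v.

Definition vect_base (k : fieldType) (U : vectType k) (i : 'I_(dim U)) : U :=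
  r2v (delta_mx 0 i).

HB.lock Definition tlift (k : fieldType) (U V : vectType k) (W : lmodType k)
    (F : U -> V -> W) (t : tensor U V) : W :=
  \sum_i \sum_j (t : 'M_(_, _)) i j *: F (vect_base i) (vect_base j).
Canonical tlift_unlockable := Unlockable tlift.unlock.

Section Tensor.
Context {k : fieldType}.

Fact tlift_linear (U V : vectType k) (W : lmodType k) (F : U -> V -> W) :
  linear (tlift F).
Proof.
move=> a x y; rewrite unlock scaler_sumr -big_split; apply: eq_bigr => i _ /=.
rewrite scaler_sumr -big_split; apply: eq_bigr => j _ /=.
by rewrite !mxE scalerDl scalerA.
Qed.

HB.instance Definition _ (U V : vectType k) (W : lmodType k)
    (F : U -> V -> W) :=
  GRing.isLinear.Build k (tensor U V) W _ (tlift F) (tlift_linear F).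

Lemma vect_baseE (U : vectType k) (u : U) :
  u = \sum_i v2r u 0 i *: vect_base i.
Proof.
apply: (can_inj v2rK); rewrite linear_sum [LHS]row_sum_delta.
by apply: eq_bigr => i _; rewrite linearZ /= r2vK.
Qed.

Lemma lin_baseE (U : vectType k) (W : lmodType k) (f : U -> W) (u : U) :
  linear f -> f u = \sum_i v2r u 0 i *: f (vect_base i).
Proof.
move=> linf; pose F := GRing.isLinear.Build _ _ _ _ f linf.
pose g : {linear U -> W} := HB.pack f F.
rewrite -[f]/(g : U -> W) {1}[u]vect_baseE linear_sum.
by apply: eq_bigr => i _; rewrite linearZ.
Qed.

Section Bilinear.
Variables (U V : vectType k).

Lemma tensDl (u1 u2 : U) (v : V) : tens (u1 + u2) v = tens u1 v + tens u2 v.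
Proof. by rewrite /tens linearD linearD /= mulmxDl. Qed.
Lemma tensDr (u : U) (v1 v2 : V) : tens u (v1 + v2) = tens u v1 + tens u v2.
Proof. by rewrite /tens linearD /= mulmxDr. Qed.
Lemma tensZl a (u : U) (v : V) : tens (a *: u) v = a *: tens u v.
Proof. by rewrite /tens !linearZ /= -scalemxAl. Qed.
Lemma tensZr a (u : U) (v : V) : tens u (a *: v) = a *: tens u v.
Proof. by rewrite /tens linearZ /= -scalemxAr. Qed.
Lemma tens0l (v : V) : tens (0 : U) v = 0.
Proof. by rewrite -(scale0r 0) tensZl scale0r. Qed.
Lemma tens0r (u : U) : tens u (0 : V) = 0.
Proof. by rewrite -(scale0r 0) tensZr scale0r. Qed.

Lemma tens_suml I (r : seq I) F (v : V) :
  tens (\sum_(i <- r) F i : U) v = \sum_(i <- r) tens (F i) v.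
Proof.
exact: (big_morph (fun u => tens u v) (fun x y => tensDl x y v) (tens0l v)).
Qed.
Lemma tens_sumr I (r : seq I) F (u : U) :
  tens u (\sum_(i <- r) F i : V) = \sum_(i <- r) tens u (F i).
Proof. exact: (big_morph (fun v => tens u v) (tensDr u) (tens0r u)). Qed.

Lemma tensE (u : U) (v : V) i j :
  (tens u v : 'M_(_, _)) i j = v2r u 0 i * v2r v 0 j.
Proof. by rewrite /tens mxE big_ord1 mxE. Qed.

Lemma tensor_base (t : tensor U V) :
  t = \sum_i \sum_j (t : 'M_(_, _)) i j *: tens (vect_base i) (vect_base j).
Proof.
rewrite [LHS]matrix_sum_delta; apply: eq_bigr => i _; apply: eq_bigr => j _.
by rewrite /tens !r2vK trmx_delta mul_delta_mx.
Qed.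

Lemma tensor_sum (t : tensor U V) :
  exists s : seq (U * V), t = \sum_(p <- s) tens p.1 p.2.
Proof.
exists [seq (t i j *: vect_base i, vect_base j) | i <- index_enum _,
                                                  j <- index_enum _].
rewrite {1}[t]tensor_base big_allpairs_dep; apply: eq_bigr => i _.
by apply: eq_bigr => j _; rewrite /= tensZl.
Qed.

Lemma tlift_tens (W : lmodType k) (F : U -> V -> W) u v :
    (forall u, linear (F u)) -> (forall v, linear (F^~ v)) ->
  tlift F (tens u v) = F u v.
Proof.
move=> linr linl; rewrite unlock [RHS](lin_baseE u (linl v)).
apply: eq_bigr => i _; rewrite (lin_baseE v (linr _)) scaler_sumr.
by apply: eq_bigr => j _; rewrite tensE scalerA.
Qed.

Lemma tlift_lin (W : lmodType k) a (F G H : U -> V -> W) t :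
    (forall u v, H u v = a *: F u v + G u v) ->
  tlift H t = a *: tlift F t + tlift G t.
Proof.
move=> HE; rewrite unlock scaler_sumr -big_split; apply: eq_bigr => i _ /=.
rewrite scaler_sumr -big_split; apply: eq_bigr => j _ /=.
by rewrite HE scalerDr !scalerA mulrC.
Qed.

End Bilinear.

Definition tmap (U V U' V' : vectType k) (f : U -> U') (g : V -> V') :
    tensor U V -> tensor U' V' :=
  tlift (fun u v => tens (f u) (g v)).

HB.instance Definition _ (U V U' V' : vectType k) (f : U -> U') (g : V -> V') :=
  GRing.Linear.on (tmap f g).

Definition tassoc (U V W : vectType k) :
    tensor (tensor U V) W -> tensor U (tensor V W) :=
  tlift (fun uv w => tlift (fun u v => tens u (tens v w)) uv).

HB.instance Definition _ (U V W : vectType k) :=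
  GRing.Linear.on (@tassoc U V W).

Definition tassocV (U V W : vectType k) :
    tensor U (tensor V W) -> tensor (tensor U V) W :=
  tlift (fun u vw => tlift (fun v w => tens (tens u v) w) vw).

HB.instance Definition _ (U V W : vectType k) :=
  GRing.Linear.on (@tassocV U V W).

Definition tmul (A : falgType k) : tensor A A -> A := tlift *%R.

HB.instance Definition _ (A : falgType k) := GRing.Linear.on (@tmul A).

Lemma tmapE (U V U' V' : vectType k) (f : {linear U -> U'})
  (g : {linear V -> V'}) u v : tmap f g (tens u v) = tens (f u) (g v).
Proof.
rewrite /tmap tlift_tens // => [u' a x y | v' a x y].
  by rewrite linearP tensDr tensZr.
by rewrite linearP tensDl tensZl.
Qed.

Lemma tassocE (U V W : vectType k) (u : U) (v : V) (w : W) :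
  tassoc (tens (tens u v) w) = tens u (tens v w).
Proof.
rewrite /tassoc tlift_tens => [|t a x y|w' a x y]; last by rewrite linearP.
  rewrite tlift_tens // => [u' a x y | v' a x y].
    by rewrite tensDl tensZl tensDr tensZr.
  by rewrite tensDl tensZl.
by apply: tlift_lin => u' v'; rewrite !tensDr !tensZr.
Qed.

Lemma tassocVE (U V W : vectType k) (u : U) (v : V) (w : W) :
  tassocV (tens u (tens v w)) = tens (tens u v) w.
Proof.
rewrite /tassocV tlift_tens => [|u' a x y|t a x y]; first 1 last.
- by rewrite linearP.
- by apply: tlift_lin => v' w'; rewrite !(tensDl, tensZl).
rewrite tlift_tens // => [u' a x y | v' a x y].
  by rewrite tensDr tensZr.
by rewrite tensDr tensZr tensDl tensZl.
Qed.

Lemma tmulE (A : falgType k) (a b : A) : tmul (tens a b) = a * b.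
Proof.
rewrite /tmul tlift_tens // => u c x y; first by rewrite mulrDr scalerAr.
by rewrite mulrDl scalerAl.
Qed.

(* tassoc and tassocV make explicit the identification of (U (x) V) (x) W with
   U (x) (V (x) W) that is left implicit in the usual equations. *)
Record twistingMap (A B : falgType k) := TwistingMap {
  twist :> {linear tensor B A -> tensor A B};
  twist_mulr : forall z : tensor B (tensor A A),
    twist (tmap idfun (@tmul A) z) =
    tmap (@tmul A) idfun (tassocV (tmap idfun twist
      (tassoc (tmap twist idfun (tassocV z)))));
  twist_mull : forall z : tensor (tensor B B) A,
    twist (tmap (@tmul B) idfun z) =
    tmap idfun (@tmul B) (tassoc (tmap twist idfun
      (tassocV (tmap idfun twist (tassoc z)))));
  twist_1l : forall a : A, twist (tens 1 a) = tens a 1;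
  twist_1r : forall b : B, twist (tens b 1) = tens 1 b
}.

Definition lrmul (A B : falgType k) (a : A) (b : B) :
    tensor A B -> tensor A B :=
  tmap (a \*o idfun) (b \o* idfun).

HB.instance Definition _ (A B : falgType k) (a : A) (b : B) :=
  GRing.Linear.on (lrmul a b).

Lemma lrmulE (A B : falgType k) (a a' : A) (b b' : B) :
  lrmul a b (tens a' b') = tens (a * a') (b' * b).
Proof. exact: tmapE. Qed.

Definition twisted_tensor (A B : falgType k) (tau : twistingMap A B) : Type :=
  tensor A B.

Section TwistedTensor.
Variables (A B : falgType k) (tau : twistingMap A B).

HB.instance Definition _ := GRing.Lmodule.on (twisted_tensor tau).

(* (mu_A (x) mu_B) o (A (x) tau (x) B), up to reassociation *)
Definition twmul (x y : tensor A B) : tensor A B :=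
  tmap (@tmul A) (@tmul B) (tassocV (tmap idfun (@tassoc A B B)
    (tmap idfun (tmap tau idfun)
      (tmap idfun (@tassocV B A B) (tassoc (tens x y)))))).

Definition twone : tensor A B := tens 1 1.

Let lr_lr (a a' : A) (b b' : B) t :
  lrmul a b (lrmul a' b' t) = lrmul (a * a') (b' * b) t.
Proof.
have [s ->] := tensor_sum t; rewrite !linear_sum /=; apply: eq_bigr => p _.
by rewrite !lrmulE !mulrA.
Qed.

Lemma twmulDl x1 x2 y : twmul (x1 + x2) y = twmul x1 y + twmul x2 y.
Proof. by rewrite /twmul tensDl !linearD. Qed.
Lemma twmulDr x y1 y2 : twmul x (y1 + y2) = twmul x y1 + twmul x y2.
Proof. by rewrite /twmul tensDr !linearD. Qed.
Lemma twmulZl a x y : twmul (a *: x) y = a *: twmul x y.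
Proof. by rewrite /twmul tensZl !linearZ. Qed.
Lemma twmulZr a x y : twmul x (a *: y) = a *: twmul x y.
Proof. by rewrite /twmul tensZr !linearZ. Qed.

Lemma twmul_suml I (r : seq I) F y :
  twmul (\sum_(i <- r) F i) y = \sum_(i <- r) twmul (F i) y.
Proof.
have z : twmul 0 y = 0 by have := twmulZl 0 0 y; rewrite !scale0r.
exact: (big_morph (twmul^~ y) (fun u v => twmulDl u v y) z).
Qed.
Lemma twmul_sumr I (r : seq I) F x :
  twmul x (\sum_(i <- r) F i) = \sum_(i <- r) twmul x (F i).
Proof.
have z : twmul x 0 = 0 by have := twmulZr 0 x 0; rewrite !scale0r.
exact: (big_morph (twmul x) (twmulDr x) z).
Qed.

Lemma twmul_pure (a a' : A) (b b' : B) :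
  twmul (tens a b) (tens a' b') = lrmul a b' (tau (tens b a')).
Proof.
rewrite /twmul tassocE tmapE /= tassocVE !(tmapE, tassocE) /= tmapE /=.
have [s ->] := tensor_sum (tau (tens b a')).
rewrite tens_suml !linear_sum /= tens_sumr !linear_sum; apply: eq_bigr => p _.
by rewrite /= tassocE tassocVE tmapE /= !tmulE lrmulE.
Qed.

Let tau_mulr b a a' s : tau (tens b a) = \sum_(p <- s) tens p.1 p.2 ->
  tau (tens b (a * a')) = \sum_(p <- s) lrmul p.1 1 (tau (tens p.2 a')).
Proof.
move=> sE; have := twist_mulr tau (tens b (tens a a')).
rewrite tmapE /= tmulE => ->; rewrite tassocVE tmapE /= sE.
rewrite tens_suml !linear_sum; apply: eq_bigr => p _ /=.
rewrite tassocE tmapE /=; have [r ->] := tensor_sum (tau (tens p.2 a')).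
rewrite tens_sumr !linear_sum; apply: eq_bigr => q _ /=.
by rewrite tassocVE tmapE /= tmulE lrmulE mulr1.
Qed.

Let tau_mull b b' a s : tau (tens b' a) = \sum_(p <- s) tens p.1 p.2 ->
  tau (tens (b * b') a) = \sum_(p <- s) lrmul 1 p.2 (tau (tens b p.1)).
Proof.
move=> sE; have := twist_mull tau (tens (tens b b') a).
rewrite tmapE /= tmulE => ->; rewrite tassocE tmapE /= sE.
rewrite tens_sumr !linear_sum; apply: eq_bigr => p _ /=.
rewrite tassocVE tmapE /=; have [r ->] := tensor_sum (tau (tens b p.1)).
rewrite tens_suml !linear_sum; apply: eq_bigr => q _ /=.
by rewrite tassocE tmapE /= tmulE lrmulE mul1r.
Qed.

Fact twmulA : associative twmul.
Proof.
move=> x y z.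
have [s ->] := tensor_sum x; rewrite !twmul_suml; apply: eq_bigr => -[a b] _ /=.
have [r ->] := tensor_sum y; rewrite !(twmul_suml, twmul_sumr).
apply: eq_bigr => -[c d] _ /=.
have [t ->] := tensor_sum z; rewrite !twmul_sumr; apply: eq_bigr => -[e f] _ /=.
rewrite !twmul_pure.
have [u uE] := tensor_sum (tau (tens b c)).
have [v vE] := tensor_sum (tau (tens d e)).
rewrite uE vE !linear_sum twmul_suml twmul_sumr /=.
transitivity (\sum_(p <- u) \sum_(q <- v)
    lrmul (a * p.1) (q.2 * f) (tau (tens p.2 q.1))); last first.
  apply: eq_bigr => p _; rewrite lrmulE twmul_pure (tau_mull _ vE) linear_sum.
  by apply: eq_bigr => q _; rewrite /= lr_lr mulr1.
rewrite exchange_big; apply: eq_bigr => q _ /=.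
rewrite lrmulE twmul_pure (tau_mulr _ uE) linear_sum.
by apply: eq_bigr => p _; rewrite /= lr_lr mul1r.
Qed.

Fact twmul1l : left_id twone twmul.
Proof.
move=> x; have [s ->] := tensor_sum x; rewrite twmul_sumr.
apply: eq_bigr => p _.
by rewrite twmul_pure twist_1l lrmulE !mul1r.
Qed.

Fact twmul1r : right_id twone twmul.
Proof.
move=> x; have [s ->] := tensor_sum x; rewrite twmul_suml.
apply: eq_bigr => p _.
by rewrite twmul_pure twist_1r lrmulE !mulr1.
Qed.

Fact twone_neq0 : twone != 0.
Proof.
have nz (C : falgType k) : exists i, v2r (1 : C) 0 i != 0.
  apply/existsP; apply: contraNT (oner_neq0 C); rewrite negb_exists => /forallP z.
  rewrite -(inj_eq (can_inj v2rK)) linear0; apply/eqP/rowP => i.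
  by rewrite [RHS]mxE; apply/eqP; rewrite -[_ == _]negbK.
have [i ni] := nz A; have [j nj] := nz B.
apply: contraNneq (mulf_neq0 ni nj) => /matrixP/(_ i j).
by rewrite tensE mxE => ->.
Qed.

HB.instance Definition _ := GRing.Zmodule_isNzRing.Build (twisted_tensor tau)
  twmulA twmul1l twmul1r twmulDl twmulDr twone_neq0.

Fact twmul_scaleAl a (x y : twisted_tensor tau) : a *: (x * y) = (a *: x) * y.
Proof. by rewrite [RHS]twmulZl. Qed.

Fact twmul_scaleAr a (x y : twisted_tensor tau) : a *: (x * y) = x * (a *: y).
Proof. by rewrite [RHS]twmulZr. Qed.

HB.instance Definition _ :=
  GRing.Lmodule_isLalgebra.Build k (twisted_tensor tau) twmul_scaleAl.
HB.instance Definition _ :=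
  GRing.Lalgebra_isAlgebra.Build k (twisted_tensor tau) twmul_scaleAr.

End TwistedTensor.

End Tensor.

HB.instance Definition _ (k : fieldType) (h : {poly k}) :=
  Vector.on {poly %/ h}.

Definition kpow (k : fieldType) (n : nat) : Type := {ffun 'I_n -> k^o}.

HB.instance Definition _ (k : fieldType) (n : nat) := Vector.on (kpow k n).
HB.instance Definition _ (k : fieldType) (n : nat) :=
  GRing.PzRing.on (kpow k n).

Section Kpow.
Variables (k : fieldType) (n : nat).

Fact kpow1_neq0 : 1 != 0 :> kpow k n.+1.
Proof. exact: (@ffun1_nonzero _ k ord0). Qed.

HB.instance Definition _ :=
  GRing.PzSemiRing_isNonZero.Build (kpow k n.+1) kpow1_neq0.

Fact kpow_scaleAl a (x y : kpow k n.+1) : a *: (x * y) = (a *: x) * y.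
Proof. by apply/ffunP => i; rewrite !ffunE scalerAl. Qed.

Fact kpow_scaleAr a (x y : kpow k n.+1) : a *: (x * y) = x * (a *: y).
Proof. by apply/ffunP => i; rewrite !ffunE scalerAr. Qed.

HB.instance Definition _ :=
  GRing.Lmodule_isLalgebra.Build k (kpow k n.+1) kpow_scaleAl.
HB.instance Definition _ :=
  GRing.Lalgebra_isAlgebra.Build k (kpow k n.+1) kpow_scaleAr.
HB.instance Definition _ := Algebra_isFalgebra.Build k (kpow k n.+1).

End Kpow.

Definition kbase (k : fieldType) (n : nat) (i : 'I_n) : kpow k n :=
  [ffun j => (j == i)%:R].

Record quiver := Quiver {
  vertex : finType;
  arrow : finType;
  src : arrow -> vertex;
  tgt : arrow -> vertex;
  vertex_gt0 : (0 < #|vertex|)%N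
}.

Definition quiver_op (Q : quiver) : quiver :=
  Quiver (@tgt Q) (@src Q) (vertex_gt0 Q).

(* The linear map sending each basis vector << p >> to F p. *)
HB.lock Definition mlift (k : fieldType) (K : choiceType) (W : lmodType k)
    (F : K -> W) (g : {malg k[K]}) : W :=
  \sum_(p <- msupp g) g@_p *: F p.
Canonical mlift_unlockable := Unlockable mlift.unlock.

Section PathAlgebra.
Variables (k : fieldType) (Q : quiver).

(* A path is given by its initial vertex and its arrows in the order in which
   they are travelled. *)
Fixpoint is_walk (x : vertex Q) (s : seq (arrow Q)) : bool :=
  if s is a :: s' then (src a == x) && is_walk (tgt a) s' else true.

Record qpath := QPath {
  qpath_val :> vertex Q * seq (arrow Q);
  qpath_walk : is_walk qpath_val.1 qpath_val.2
}.

HB.instance Definition _ := [isSub for qpath_val].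
HB.instance Definition _ := [Choice of qpath by <:].

Definition psrc (p : qpath) : vertex Q := (val p).1.
Definition ptgt (p : qpath) : vertex Q :=
  last (psrc p) (map (@tgt Q) (val p).2).
Definition plen (p : qpath) : nat := size (val p).2.

Definition triv (x : vertex Q) : qpath := @QPath (x, [::]) isT.

Lemma walk_cat x s t :
  is_walk x (s ++ t) =
  is_walk x s && is_walk (last x (map (@tgt Q) s)) t.
Proof. by elim: s x => //= a s IHs x; rewrite IHs andbA. Qed.

(* The path p followed by q, when p ends where q begins: arrows are multiplied
   as maps. *)
Definition pcomp (q p : qpath) : option qpath :=
  if ptgt p == psrc q then insub (psrc p, (val p).2 ++ (val q).2) else None.

Variant pcomp_spec (q p : qpath) : option qpath -> Prop :=
| PcompSome r of ptgt p = psrc q & psrc r = psrc p & ptgt r = ptgt q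
    & (val r).2 = (val p).2 ++ (val q).2 : pcomp_spec q p (Some r)
| PcompNone of ptgt p != psrc q : pcomp_spec q p None.

Lemma pcompP q p : pcomp_spec q p (pcomp q p).
Proof.
rewrite /pcomp; case: eqP => [e|/eqP ne]; last by constructor.
case: insubP => [r _ rE|/negP[]]; last first.
  by rewrite /= walk_cat qpath_walk [last _ _]e qpath_walk.
constructor; rewrite // /ptgt /psrc rE //=.
by rewrite map_cat last_cat [last _ (map _ (val p).2)]e.
Qed.

Lemma qpath_eq p q : psrc p = psrc q -> (val p).2 = (val q).2 -> p = q.
Proof.
case: p q => [[x s] ?] [[y t] ?]; rewrite /psrc /= => exy est.
by apply: val_inj; rewrite /= exy est.
Qed.

Definition path_algebra : Type := {malg k[qpath]}.
HB.instance Definition _ := GRing.Lmodule.on path_algebra.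

Definition of_path (p : qpath) : path_algebra := << p >>.
Definition of_opath (o : option qpath) : path_algebra := oapp of_path 0 o.

Definition pmul (g h : path_algebra) : path_algebra :=
  mlift (fun q => mlift (fun p => of_opath (pcomp q p)) h) g.

Definition pone : path_algebra := \sum_(x : vertex Q) of_path (triv x).

Lemma mliftw (W : lmodType k) (F : qpath -> W) (g : path_algebra)
    (d : {fset qpath}) : (msupp g `<=` d)%fset ->
  mlift F g = \sum_(p <- d) g@_p *: F p.
Proof.
move=> le; rewrite unlock; apply: big_fset_incl => // p _ /mcoeff_outdom ->.
by rewrite scale0r.
Qed.

Fact mlift_linear (W : lmodType k) (F : qpath -> W) : linear (mlift F).
Proof.
move=> a x y; pose d := (msupp x `|` msupp y)%fset.
have sx : (msupp x `<=` d)%fset by apply: fsubsetUl.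
have sy : (msupp y `<=` d)%fset by apply: fsubsetUr.
have sxy : (msupp (a *: x + y : {malg k[qpath]}) `<=` d)%fset.
  apply: fsubset_trans (msuppD_le _ _) _; apply: fsetSU; exact: msuppZ_le.
rewrite (mliftw _ sx) (mliftw _ sy) (mliftw _ sxy).
rewrite scaler_sumr -big_split; apply: eq_bigr => p _ /=.
by rewrite mcoeffD mcoeffZ scalerDl scalerA.
Qed.

HB.instance Definition _ (W : lmodType k) (F : qpath -> W) :=
  GRing.isLinear.Build k path_algebra W _ (mlift F) (mlift_linear F).

Lemma mliftU (W : lmodType k) (F : qpath -> W) p : mlift F (of_path p) = F p.
Proof. by rewrite (mliftw F msuppU_le) big_seq_fset1 mcoeffUU scale1r. Qed.

Lemma pmulDl : left_distributive pmul +%R.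
Proof. by move=> x y z; rewrite /pmul linearD. Qed.
Lemma pmulZl a x y : pmul (a *: x) y = a *: pmul x y.
Proof. by rewrite /pmul linearZ. Qed.
Lemma pmulDr : right_distributive pmul +%R.
Proof.
move=> x y z; rewrite /pmul !(mliftw _ (fsubset_refl (msupp x))) -big_split.
by apply: eq_bigr => p _ /=; rewrite linearD scalerDr.
Qed.
Lemma pmulZr a x y : pmul x (a *: y) = a *: pmul x y.
Proof.
rewrite /pmul !(mliftw _ (fsubset_refl (msupp x))) scaler_sumr.
by apply: eq_bigr => p _ /=; rewrite linearZ !scalerA mulrC.
Qed.

Lemma pmul_suml I (r : seq I) (P : pred I) F y :
  pmul (\sum_(i <- r | P i) F i) y = \sum_(i <- r | P i) pmul (F i) y.
Proof.
have z : pmul 0 y = 0 by have := pmulZl 0 0 y; rewrite !scale0r.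
exact: (big_morph (pmul^~ y) (fun u v => pmulDl u v y) z).
Qed.
Lemma pmul_sumr I (r : seq I) (P : pred I) F x :
  pmul x (\sum_(i <- r | P i) F i) = \sum_(i <- r | P i) pmul x (F i).
Proof.
have z : pmul x 0 = 0 by have := pmulZr 0 x 0; rewrite !scale0r.
exact: (big_morph (pmul x) (pmulDr x) z).
Qed.

Lemma pmulU q p : pmul (of_path q) (of_path p) = of_opath (pcomp q p).
Proof. by rewrite /pmul !mliftU. Qed.

Lemma path_algebraE (g : path_algebra) :
  g = \sum_(p <- msupp g) g@_p *: of_path p.
Proof.
rewrite {1}[g]monalgE; apply: eq_bigr => p _.
by apply/malgP => q; rewrite mcoeffZ !mcoeffU mulrnAr mulr1.
Qed.

Lemma pmulUA r q p :
  pmul (of_path r) (pmul (of_path q) (of_path p)) =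
  pmul (pmul (of_path r) (of_path q)) (of_path p).
Proof.
have p0 x : pmul x 0 = 0 by have := pmulZr 0 x 0; rewrite !scale0r.
have p0' x : pmul 0 x = 0 by have := pmulZl 0 0 x; rewrite !scale0r.
rewrite !pmulU; case: pcompP => [u pq us ut uE|pq];
  case: pcompP => [v qr vs vt vE|qr]; rewrite /= ?(p0, p0') ?pmulU //.
- case: pcompP => [w _ ws wt wE|]; last by rewrite ut qr eqxx.
  case: pcompP => [w' _ ws' wt' wE'|]; last by rewrite vs pq eqxx.
  congr of_path; apply: qpath_eq; first by rewrite ws ws' us.
  by rewrite wE wE' uE vE catA.
- by case: pcompP => // w e; rewrite -ut e eqxx in qr.
- by case: pcompP => // w e; rewrite -vs -e eqxx in pq.
Qed.

Fact pmulA : associative pmul.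
Proof.
move=> x y z; rewrite [x]path_algebraE !pmul_suml; apply: eq_bigr => r _.
rewrite !pmulZl; congr (_ *: _).
rewrite [y]path_algebraE pmul_suml !pmul_sumr pmul_suml.
apply: eq_bigr => q _; rewrite !(pmulZl, pmulZr); congr (_ *: _).
rewrite [z]path_algebraE !pmul_sumr; apply: eq_bigr => p _.
by rewrite !pmulZr pmulUA.
Qed.

Fact pmul1l : left_id pone pmul.
Proof.
move=> x; rewrite [x]path_algebraE pmul_sumr; apply: eq_bigr => p _.
rewrite pmulZr pmul_suml (bigD1 (ptgt p)) //= big1 => [|y ny].
  rewrite addr0 pmulU; congr (_ *: _); case: pcompP => [r _ rs _ rE|].
    by congr of_path; apply: qpath_eq => //; rewrite rE cats0.
  by rewrite eqxx.
by rewrite pmulU; case: pcompP => // r e; rewrite e eqxx in ny.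
Qed.

Fact pmul1r : right_id pone pmul.
Proof.
move=> x; rewrite [x]path_algebraE pmul_suml; apply: eq_bigr => p _.
rewrite pmulZl pmul_sumr (bigD1 (psrc p)) //= big1 => [|y ny].
  rewrite addr0 pmulU; congr (_ *: _); case: pcompP => [r _ rs _ rE|].
    by congr of_path; apply: qpath_eq.
  by rewrite eqxx.
by rewrite pmulU; case: pcompP => // r e; rewrite -e eqxx in ny.
Qed.

Lemma coef_pone (x : vertex Q) : (pone : {malg k[qpath]})@_(triv x) = 1.
Proof.
rewrite /pone raddf_sum (bigD1 x) //= mcoeffUU big1 ?addr0 // => y ny.
rewrite mcoeffU; case: eqP => // /(congr1 psrc) e.
by rewrite -[y]/(psrc (triv y)) e eqxx in ny.
Qed.

Fact pone_neq0 : pone != 0.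
Proof.
have /card_gt0P[x _] := vertex_gt0 Q.
apply: contraNneq (oner_neq0 k) => p0.
by rewrite -(coef_pone x) p0 mcoeff0.
Qed.

HB.instance Definition _ := GRing.Zmodule_isNzRing.Build path_algebra
  pmulA pmul1l pmul1r pmulDl pmulDr pone_neq0.

Fact pmul_scaleAl a (x y : path_algebra) : a *: (x * y) = (a *: x) * y.
Proof. by rewrite [RHS]pmulZl. Qed.
Fact pmul_scaleAr a (x y : path_algebra) : a *: (x * y) = x * (a *: y).
Proof. by rewrite [RHS]pmulZr. Qed.

HB.instance Definition _ :=
  GRing.Lmodule_isLalgebra.Build k path_algebra pmul_scaleAl.
HB.instance Definition _ :=
  GRing.Lalgebra_isAlgebra.Build k path_algebra pmul_scaleAr.

End PathAlgebra.

Section Quotient.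
Variables (k : fieldType) (A : algType k).

Definition two_sided_ideal (I : A -> Prop) : Prop :=
  [/\ I 0, forall x y, I x -> I y -> I (x - y),
      forall a x, I x -> I (a * x) & forall a x, I x -> I (x * a)].

Definition ideal_gen (S : A -> Prop) (x : A) : Prop :=
  forall I, two_sided_ideal I -> (forall s, S s -> I s) -> I x.

Lemma ideal_gen_ideal (S : A -> Prop) : two_sided_ideal (ideal_gen S).
Proof.
split=> [I [] //|x y Sx Sy I iI SI|a x Sx I iI SI|a x Sx I iI SI].
- by case: (iI) => _ h _ _; apply: h; [apply: Sx|apply: Sy].
- by case: (iI) => _ _ h _; apply: h; exact: Sx.
- by case: (iI) => _ _ _ h; apply: h; exact: Sx.
Qed.

Lemma mem_ideal_gen (S : A -> Prop) s : S s -> ideal_gen S s.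
Proof. by move=> Ss I _; apply. Qed.

Record properIdeal := ProperIdeal {
  in_ideal :> A -> Prop;
  in_idealP : two_sided_ideal in_ideal;
  ideal_proper : ~ in_ideal 1
}.

Variable I : properIdeal.

Lemma ideal0 : I 0. Proof. by case: (in_idealP I). Qed.
Lemma idealB x y : I x -> I y -> I (x - y).
Proof. by case: (in_idealP I) => _ h _ _; apply: h. Qed.
Lemma idealMl a x : I x -> I (a * x).
Proof. by case: (in_idealP I) => _ _ h _; apply: h. Qed.
Lemma idealMr a x : I x -> I (x * a).
Proof. by case: (in_idealP I) => _ _ _; apply. Qed.
Lemma idealN x : I x -> I (- x).
Proof. by move=> Ix; rewrite -sub0r; apply: idealB Ix; apply: ideal0. Qed.
Lemma idealD x y : I x -> I y -> I (x + y).
Proof. by move=> Ix Iy; rewrite -[y]opprK; apply: idealB Ix _; apply: idealN. Qed.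
Lemma idealZ (a : k) x : I x -> I (a *: x).
Proof. by move=> Ix; rewrite -[x]mul1r scalerAl; apply: idealMl. Qed.

Definition ideal_equiv (x y : A) : bool := `[< I (x - y) >].

Fact ideal_equiv_is_equiv : equiv_class_of ideal_equiv.
Proof.
split=> [x|x y|y x z].
- apply/asboolP; rewrite subrr; exact: ideal0.
- by apply/idP/idP => /asboolP/idealN; rewrite opprB => ?; apply/asboolP.
- by move=> /asboolP xy /asboolP yz; apply/asboolP;
    rewrite -(subrKA y); apply: idealD.
Qed.

Canonical ideal_equiv_equiv := EquivRelPack ideal_equiv_is_equiv.

Local Open Scope quotient_scope.

Definition quot_alg : Type := {eq_quot ideal_equiv}.

HB.instance Definition _ : EqQuotient A ideal_equiv quot_alg :=
  EqQuotient.on quot_alg.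
HB.instance Definition _ := Choice.on quot_alg.

Lemma quot_eqP (x y : A) : reflect (I (x - y)) (x == y %[mod quot_alg]).
Proof. by rewrite piE; apply: asboolP. Qed.

Lemma quot_eq (x y : A) : I (x - y) -> \pi_quot_alg x = \pi_quot_alg y.
Proof. by move=> Ixy; apply/eqP/quot_eqP. Qed.

Lemma quot_repr (x : A) : I (repr (\pi_quot_alg x) - x).
Proof. by apply/quot_eqP; rewrite reprK. Qed.

Definition qzero : quot_alg := \pi_quot_alg 0.
Definition qone : quot_alg := \pi_quot_alg 1.
Definition qopp : quot_alg -> quot_alg :=
  locked (fun x => \pi_quot_alg (- repr x)).
Definition qadd : quot_alg -> quot_alg -> quot_alg :=
  locked (fun x y => \pi_quot_alg (repr x + repr y)).
Definition qmul : quot_alg -> quot_alg -> quot_alg :=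
  locked (fun x y => \pi_quot_alg (repr x * repr y)).
Definition qscale : k -> quot_alg -> quot_alg :=
  locked (fun a x => \pi_quot_alg (a *: repr x)).

Lemma qoppE x : qopp (\pi_quot_alg x) = \pi_quot_alg (- x).
Proof.
rewrite /qopp -lock; apply: quot_eq; rewrite opprK addrC -opprB.
by apply: idealN; apply: quot_repr.
Qed.
Lemma qaddE x y : qadd (\pi_quot_alg x) (\pi_quot_alg y) = \pi_quot_alg (x + y).
Proof.
rewrite /qadd -lock; apply: quot_eq; rewrite opprD addrACA.
by apply: idealD; apply: quot_repr.
Qed.
Lemma qmulE x y : qmul (\pi_quot_alg x) (\pi_quot_alg y) = \pi_quot_alg (x * y).
Proof.
rewrite /qmul -lock; apply: quot_eq; set x' := repr _; set y' := repr _.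
rewrite -(subrKA (x' * y)) -mulrBr -mulrBl.
by apply: idealD; [apply: idealMl|apply: idealMr]; apply: quot_repr.
Qed.
Lemma qscaleE a x : qscale a (\pi_quot_alg x) = \pi_quot_alg (a *: x).
Proof.
rewrite /qscale -lock; apply: quot_eq; rewrite -scalerBr.
by apply: idealZ; apply: quot_repr.
Qed.

Fact qaddA : associative qadd.
Proof. by do 3!elim/quotW => ?; rewrite !qaddE addrA. Qed.
Fact qaddC : commutative qadd.
Proof. by do 2!elim/quotW => ?; rewrite !qaddE addrC. Qed.
Fact qadd0 : left_id qzero qadd.
Proof. by elim/quotW => ?; rewrite !qaddE add0r. Qed.
Fact qaddN : left_inverse qzero qopp qadd.
Proof. by elim/quotW => ?; rewrite qoppE qaddE addNr. Qed.

HB.instance Definition _ :=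
  GRing.isZmodule.Build quot_alg qaddA qaddC qadd0 qaddN.

Fact qmulA : associative qmul.
Proof. by do 3!elim/quotW => ?; rewrite !qmulE mulrA. Qed.
Fact qmul1l : left_id qone qmul.
Proof. by elim/quotW => ?; rewrite !qmulE mul1r. Qed.
Fact qmul1r : right_id qone qmul.
Proof. by elim/quotW => ?; rewrite !qmulE mulr1. Qed.
Fact qmulDl : left_distributive qmul qadd.
Proof. by do 3!elim/quotW => ?; rewrite !(qmulE, qaddE) mulrDl. Qed.
Fact qmulDr : right_distributive qmul qadd.
Proof. by do 3!elim/quotW => ?; rewrite !(qmulE, qaddE) mulrDr. Qed.
Fact qone_neq0 : qone != qzero.
Proof. by apply/negP => /quot_eqP; rewrite subr0; apply: ideal_proper. Qed.

HB.instance Definition _ := GRing.Zmodule_isNzRing.Build quot_alg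
  qmulA qmul1l qmul1r qmulDl qmulDr qone_neq0.

Fact qscaleA a b x : qscale a (qscale b x) = qscale (a * b) x.
Proof. by elim/quotW: x => ?; rewrite !qscaleE scalerA. Qed.
Fact qscale1 : left_id 1 qscale.
Proof. by elim/quotW => ?; rewrite !qscaleE scale1r. Qed.
Fact qscaleDr : right_distributive qscale qadd.
Proof. by move=> a; do 2!elim/quotW => ?; rewrite !(qscaleE, qaddE) scalerDr. Qed.
Fact qscaleDl x : {morph qscale^~ x : a b / a + b >-> qadd a b}.
Proof. by elim/quotW: x => ? a b; rewrite !(qscaleE, qaddE) scalerDl. Qed.

HB.instance Definition _ := GRing.Zmodule_isLmodule.Build k quot_alg
  qscaleA qscale1 qscaleDr qscaleDl.

Fact qscaleAl (a : k) (x y : quot_alg) : a *: (x * y) = (a *: x) * y.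
Proof.
elim/quotW: x => x; elim/quotW: y => y.
by rewrite -[LHS]/(qscale a (qmul _ _)) -[RHS]/(qmul (qscale a _) _)
  !(qscaleE, qmulE) scalerAl.
Qed.
Fact qscaleAr (a : k) (x y : quot_alg) : a *: (x * y) = x * (a *: y).
Proof.
elim/quotW: x => x; elim/quotW: y => y.
by rewrite -[LHS]/(qscale a (qmul _ _)) -[RHS]/(qmul _ (qscale a _))
  !(qscaleE, qmulE) scalerAr.
Qed.

HB.instance Definition _ :=
  GRing.Lmodule_isLalgebra.Build k quot_alg qscaleAl.
HB.instance Definition _ :=
  GRing.Lalgebra_isAlgebra.Build k quot_alg qscaleAr.

End Quotient.

Section LongPaths.
Variables (k : fieldType) (Q : quiver).

Definition long_path (g : path_algebra k Q) : Prop :=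
  exists2 p : qpath Q, (1 < plen p)%N & g = of_path k p.

Definition long_coef (g : path_algebra k Q) : Prop :=
  forall p : qpath Q, (plen p <= 1)%N -> (g : {malg k[qpath Q]})@_p = 0.

Lemma long_coef_ideal : two_sided_ideal long_coef.
Proof.
have coef_prod (g h : path_algebra k Q) p :
    (g * h : {malg k[qpath Q]})@_p =
    \sum_(q <- msupp g) \sum_(r <- msupp h)
      g@_q * h@_r * (of_opath k (pcomp q r) : {malg k[qpath Q]})@_p.
  rewrite -[g * h]/(pmul g h) /pmul (mliftw _ (fsubset_refl (msupp g))).
  rewrite (raddf_sum (mcoeff p)); apply: eq_bigr => q _ /=.
  rewrite (mliftw _ (fsubset_refl (msupp h))) mcoeffZ (raddf_sum (mcoeff p)).
  by rewrite mulr_sumr; apply: eq_bigr => r _ /=; rewrite mcoeffZ mulrA.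
have coef_comp q r p : (plen p <= 1)%N ->
    (1 < plen q)%N || (1 < plen r)%N ->
    (of_opath k (pcomp q r) : {malg k[qpath Q]})@_p = 0.
  move=> lp lqr; case: pcompP => [s _ _ _ sE|_]; last exact: mcoeff0.
  rewrite mcoeffU; case: eqP => // sp; move: lp; rewrite -sp /plen sE size_cat.
  rewrite leqNgt => /negP[]; case/orP: lqr => h; apply: leq_trans h _.
    exact: leq_addl.
  exact: leq_addr.
split=> [p _|x y Ix Iy p lp|a x Ix p lp|a x Ix p lp].
- exact: mcoeff0.
- by rewrite mcoeffB Ix ?Iy ?subrr.
- rewrite coef_prod big1 // => q _; rewrite big1 // => r _.
  have [lr|lr] := leqP (plen r) 1; first by rewrite (Ix r lr) mulr0 mul0r.
  by rewrite coef_comp ?lr ?orbT ?mulr0.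
- rewrite coef_prod big1 // => q _; rewrite big1 // => r _.
  have [lr|lr] := leqP (plen q) 1; first by rewrite (Ix q lr) !mul0r.
  by rewrite coef_comp ?lr ?mulr0.
Qed.

Lemma long_ideal_proper : ~ ideal_gen long_path 1.
Proof.
have /card_gt0P[x _] := vertex_gt0 Q.
move=> /(_ _ long_coef_ideal) long1.
have /long1/(_ (triv x) isT) : forall s, long_path s -> long_coef s.
  move=> _ [p lp ->] q lq; rewrite mcoeffU; case: eqP => // pq.
  by move: lq; rewrite -pq leqNgt lp.
by move/eqP; rewrite coef_pone oner_eq0.
Qed.

(* (Q_{>=2}), so that path_algebra_lt2 is kQ / (Q_{>=2}). *)
Definition long_ideal : properIdeal (path_algebra k Q) :=
  ProperIdeal (ideal_gen_ideal long_path) long_ideal_proper.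

Definition path_algebra_lt2 : Type := quot_alg long_ideal.
HB.instance Definition _ := GRing.Algebra.on path_algebra_lt2.

End LongPaths.

Definition alg_isomorphic (k : fieldType) (A B : algType k) : Prop :=
  exists g : {lrmorphism A -> B}, bijective g.

Definition adjacent (Q : quiver) : rel (vertex Q) :=
  fun x y => [exists a : arrow Q, (src a == x) && (tgt a == y)].

Definition connected_quiver (Q : quiver) : Prop :=
  forall x y : vertex Q,
    connect (fun u v => adjacent u v || adjacent v u) x y.

(* Since p is monic of degree 2, {poly %/ poly_p alpha beta} is
   k[x]/(p) (mk_monic_poly_p), with 'qX the class of x. *)
Definition poly_p (k : fieldType) (alpha beta : k) : {poly k} :=
  'X^2 - alpha *: 'X + beta%:P.
Definition poly_q (k : fieldType) (alpha beta : k) : {poly k} :=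
  'X^2 + alpha *: 'X + beta%:P.

Lemma mk_monic_poly_p (k : fieldType) (alpha beta : k) :
  mk_monic (poly_p alpha beta) = poly_p alpha beta.
Proof.
have sr : (size (- (alpha *: 'X) + beta%:P : {poly k})%R < 3)%N.
  rewrite (leq_ltn_trans (size_polyD _ _)) // gtn_max size_polyN.
  rewrite (leq_ltn_trans (size_scale_leq _ _)) ?size_polyX //=.
  by rewrite (leq_ltn_trans (size_polyC_leq1 _)).
have sp : size (poly_p alpha beta) = 3.
  by rewrite /poly_p -addrA size_polyDl size_polyXn.
rewrite /mk_monic sp /= monicE /poly_p -addrA lead_coefDl ?size_polyXn //.
by rewrite lead_coefXn eqxx.
Qed.

Section ColoredQuiver.
Variables (k : fieldType) (n : nat).
Implicit Types (phi : 'I_n.+1 -> 'I_n.+1) (col : 'I_n.+1 -> k).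

Definition twisting_pair (alpha beta : k)
    (tau : twistingMap (kpow k n.+1) {poly %/ poly_p alpha beta})
    (f delta : kpow k n.+1 -> kpow k n.+1) : Prop :=
  forall a, tau (tens 'qX a) = tens (delta a) 1 + tens (f a) 'qX.

Definition induced_map (f : kpow k n.+1 -> kpow k n.+1) phi : Prop :=
  forall i, f (kbase k i) = \sum_(j | phi j == i) kbase k j.

Definition coloration (delta : kpow k n.+1 -> kpow k n.+1) phi col : Prop :=
  (forall i, phi i = i -> col i = 0) /\
  (forall i, delta (kbase k i) =
     \sum_(j | phi j == i) col j *: kbase k j - col i *: kbase k i).

(* Q_f, with one arrow i -> phi i for each vertex i. *)
Definition map_quiver phi : quiver :=
  Quiver (vertex := 'I_n.+1) (arrow := 'I_n.+1) id phi
    (introT card_gt0P (ex_intro _ ord0 isT)).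

(* is_cycle and is_strict_cycle are used for connected quivers, where the
   oriented cycle c is unique. *)
Definition is_cycle (s : nat) phi : Prop :=
  exists c : seq 'I_n.+1, size c = s /\ ufcycle phi c.

Definition is_strict_cycle (s : nat) phi : Prop :=
  exists c : seq 'I_n.+1, [/\ size c = s, ufcycle phi c & forall i, i \in c].

(* The vertices of the quiver Q^ are the non-loop vertices inl i of Q and the
   two new vertices 1 = inr ord0 and 2 = inr ord_max. *)
Definition hat_vertex phi : finType := ({i | phi i != i} + 'I_2)%type.

Definition hat_arrow phi col (r1 r2 : k) (u v : hat_vertex phi) : bool :=
  match u, v with
  | inl i, inl j => phi (val i) == val j
  | inl i, inr m =>
      (phi (phi (val i)) == phi (val i)) &&
      (col (val i) == if m == ord0 then r1 else r2)
  | inr _, _ => false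
  end.

Definition hat_quiver phi col (r1 r2 : k) : quiver :=
  Quiver (vertex := hat_vertex phi)
    (arrow := {uv : hat_vertex phi * hat_vertex phi |
                 hat_arrow col r1 r2 uv.1 uv.2})
    (fun uv => (val uv).1) (fun uv => (val uv).2)
    (introT card_gt0P (ex_intro _ (inr ord0) isT)).

End ColoredQuiver.

(* Main.v *)
Require Import Defs.
From HB Require Import structures.
From mathcomp Require Import all_boot all_order all_algebra all_field.
From mathcomp Require Import monalg boolp ring.

Set Implicit Arguments.
Unset Strict Implicit.
Unset Printing Implicit Defensive.

Import GRing.Theory.

Local Open Scope ring_scope.

(** Write [e_i] for the [i]-th basis idempotent of [k^n], seen in [R], and [x]
    for the generator of [k[x]/(p)]. The formulas for [f] and [delta] say that
    [x e_i = \sum_(phi j = i) e_j (x + a_j) - a_i e_i]. Hence the elements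
    [y_i = e_i (x + a_i)] satisfy [e_i y_i = y_i = y_i e_(phi i)]: they behave
    like arrows from [phi i] to [i], and the [e_i] and [y_i] together form a
    basis of [R]. So [R] has the vertices and arrows of [Q^op] as a basis, and
    all that remains is the product of two consecutive arrows, which is
    [y_i y_(phi i) = (alpha + a_i + a_(phi i)) y_i - q(a_i) e_i]
    ([peirce_arrow_mul]).

    The left side lies in [e_i R e_(phi (phi i))]. Comparing Peirce components,
    the coefficient of [y_i] vanishes unless [phi i] is a loop vertex, and
    [q(a_i)] vanishes unless [phi (phi i) = i] ([peirce_arrow_two_step]). This
    settles every case.

    - Without loop, and outside the strict 2-cycle, all these products are
      zero: a vertex hanging on a 2-cycle forces the colors of the 2-cycle to
      be roots of [q]. So [R] is [k(Q^op)] modulo the paths of length two.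
    - On a strict 2-cycle, the two products are [c e_u] and [c e_v] for the
      same scalar [c]. Either [c = 0], or rescaling one arrow gives matrix
      units.
    - With a loop at [l], the element [y_l = e_l x] is a root of [p] in
      [e_l R e_l], and the color [a_i] of any other vertex is a root of [q], so
      that [- a_i] and [alpha + a_i] are roots of [p]. If [p] has no root, the
      loop is therefore the whole quiver. Otherwise, an arrow [y_i] with
      [phi i = l] and [i <> l] is an eigenvector of the right multiplication by
      [y_l], for the eigenvalue [alpha + a_i]. If [p] has a double root [rho],
      then [y_l - rho e_l] is a nilpotent loop that annihilates these [y_i]. If
      [p] has two distinct roots, then [e_l] splits into the two spectral
      idempotents of [y_l], and each [y_i] is attached to the one of its
      eigenvalue: this is the quiver with the loop vertex replaced by two
      vertices.

    Isomorphisms with a truncated path algebra come from [path_system_iso]: an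
    algebra with a basis that multiplies like the vertices and arrows of a
    quiver, with all products of two arrows zero, is [kQ_{<2}]. *)

(** * Recognizing an algebra from a multiplicative basis *)

Lemma alg_isomorphic_of_inverse (k : fieldType) (A B : algType k)
    (h : {lrmorphism B -> A}) (g : A -> B) :
  cancel g h -> cancel h g -> alg_isomorphic A B.
Proof.
move=> gK hK.
have g_lin : linear g.
  by move=> a u v; apply: (can_inj hK); rewrite linearP /= !gK.
have g_mul : monoid_morphism g.
  split=> [|u v]; apply: (can_inj hK); first by rewrite gK rmorph1.
  by rewrite rmorphM /= !gK.
pose gL := GRing.isLinear.Build k A B _ g g_lin.
pose gM := GRing.isMonoidMorphism.Build A B g g_mul.
pose G : {lrmorphism A -> B} := HB.pack g gL gM.
by exists G, h.
Qed.

Lemma first_isomorphism (k : fieldType) (A R : algType k) (I : properIdeal A)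
    (h : {lrmorphism A -> R}) :
  (forall r, exists a, h a = r) -> (forall a, I a <-> h a = 0) ->
  alg_isomorphic R (quot_alg I).
Proof.
move=> h_surj kerh;
pose g (r : R) := \pi_(quot_alg I)%qT (sval (cid (h_surj r))).
pose hb (z : quot_alg I) : R := h (repr z).
have hbE a : hb (\pi_(quot_alg I)%qT a) = h a.
  by apply/eqP; rewrite -subr_eq0 -raddfB; apply/eqP/kerh/quot_repr.
have gK : cancel g hb by move=> r; rewrite hbE; case: (cid _).
have hbK : cancel hb g.
  elim/quotW=> a; rewrite hbE; apply: quot_eq; apply/kerh.
  by rewrite raddfB /=; case: (cid _) => b /= ->; rewrite subrr.
have hb_lin : linear hb.
  move=> c; elim/quotW=> a; elim/quotW=> b.
  rewrite -[c *: _ + _]/(qadd (qscale c _) _) qscaleE qaddE !hbE.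
  exact: linearP.
have hb_mul : monoid_morphism hb.
  split; first by rewrite -[1]/(qone I) hbE rmorph1.
  elim/quotW=> a; elim/quotW=> b.
  by rewrite -[_ * _]/(qmul _ _) qmulE !hbE rmorphM.
pose hL := GRing.isLinear.Build k (quot_alg I) R _ hb hb_lin.
pose hM := GRing.isMonoidMorphism.Build (quot_alg I) R hb hb_mul.
pose H : {lrmorphism quot_alg I -> R} := HB.pack hb hL hM.
exact: (@alg_isomorphic_of_inverse k R (quot_alg I) H g gK hbK).
Qed.

(** A system of matrix units is automatically linearly independent: multiplying
    by units on both sides isolates each coefficient. So spanning suffices. *)
Lemma matrix_units_iso (k : fieldType) (m : nat) (R : algType k)
    (G : 'I_m.+1 -> 'I_m.+1 -> R) :
    (forall i j u v, G i j * G u v = if j == u then G i v else 0) ->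
    \sum_i G i i = 1 ->
    (forall r, exists M : 'M[k]_m.+1, r = \sum_i \sum_j M i j *: G i j) ->
  alg_isomorphic R 'M[k]_m.+1.
Proof.
move=> GM G1 G_span.
pose h (M : 'M[k]_m.+1) : R := \sum_i \sum_j M i j *: G i j.
have G_neq0 : G ord0 ord0 != 0.
  apply: contra_neq (oner_neq0 R) => G0; rewrite -G1 big1 // => i _.
  have -> : G i i = G i ord0 * G ord0 ord0 * G ord0 i.
    by rewrite GM eqxx GM eqxx.
  by rewrite G0 mulr0 mul0r.
have h_coef M i j : G ord0 i * h M * G j ord0 = M i j *: G ord0 ord0.
  rewrite mulr_sumr mulr_suml (bigD1 i) //= [X in _ + X]big1 => [|u /negPf nu].
    rewrite addr0 mulr_sumr mulr_suml (bigD1 j) //=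
      [X in _ + X]big1 => [|v /negPf nv].
      by rewrite addr0 -scalerAr GM eqxx -scalerAl GM eqxx.
    by rewrite -scalerAr GM eqxx -scalerAl GM nv scaler0.
  rewrite mulr_sumr mulr_suml big1 // => v _.
  by rewrite -scalerAr GM eq_sym nu scaler0 mul0r.
have h_lin : linear h.
  move=> c M N; rewrite scaler_sumr -big_split; apply: eq_bigr => i _ /=.
  rewrite scaler_sumr -big_split; apply: eq_bigr => j _ /=.
  by rewrite !mxE scalerDl scalerA.
have h_mul : monoid_morphism h.
  split.
    rewrite /h -G1; apply: eq_bigr => i _.
    rewrite (bigD1 i) //= mxE eqxx scale1r big1 ?addr0 // => j ji.
    by rewrite mxE eq_sym (negPf ji) scale0r.
  move=> M N; rewrite /h mulr_suml; apply: eq_bigr => i _.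
  transitivity (\sum_j \sum_v (M i v * N v j) *: G i j).
    by apply: eq_bigr => j _; rewrite mxE scaler_suml.
  rewrite exchange_big mulr_suml; apply: eq_bigr => v _ /=.
  rewrite mulr_sumr [RHS](bigD1 v) //= [X in _ = _ + X]big1 => [|u /negPf nu].
    rewrite addr0 mulr_sumr; apply: eq_bigr => j _.
    by rewrite -scalerAl -scalerAr scalerA GM eqxx.
  rewrite mulr_sumr big1 // => j _.
  by rewrite -scalerAl -scalerAr GM eq_sym nu !scaler0.
pose hL := GRing.isLinear.Build k 'M[k]_m.+1 R _ h h_lin.
pose hM := GRing.isMonoidMorphism.Build 'M[k]_m.+1 R h h_mul.
pose H : {lrmorphism 'M[k]_m.+1 -> R} := HB.pack h hL hM.
pose g r := sval (cid (G_span r)).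
have gK : cancel g h by move=> r; rewrite /g; case: (cid _).
apply: (@alg_isomorphic_of_inverse k R 'M[k]_m.+1 H g) => // M.
apply/matrixP => i j; apply/eqP; rewrite -subr_eq0.
suff /eqP : (g (H M) i j - M i j) *: G ord0 ord0 = 0.
  by rewrite scaler_eq0 (negPf G_neq0) orbF.
by rewrite scalerBl -!h_coef gK subrr.
Qed.

(** The combinations of vertices and arrows form a complement of the ideal of
    long paths in [kQ]. An algebra with such a basis, in which products of
    arrows vanish, is therefore the quotient of [kQ] by that ideal. *)
Section PathSystem.
Variables (k : fieldType) (Q : quiver) (R : algType k).
Variables (e : vertex Q -> R) (y : arrow Q -> R).

Definition vertex_arrow_comb (c : vertex Q -> k) (d : arrow Q -> k) : R :=
  \sum_u c u *: e u + \sum_a d a *: y a.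

Record path_system : Prop := PathSystem {
  vertex_orth : forall u v, e u * e v = if u == v then e u else 0;
  vertex_sum1 : \sum_u e u = 1;
  arrow_tgtE : forall a, e (tgt a) * y a = y a;
  arrow_srcE : forall a, y a * e (src a) = y a;
  arrow_mul0 : forall a b, y a * y b = 0
}.

Definition path_free : Prop :=
  forall c d, vertex_arrow_comb c d = 0 ->
    (forall u, c u = 0) /\ (forall a, d a = 0).

Definition path_spanned (r : R) : Prop := exists c d, r = vertex_arrow_comb c d.

Lemma path_spanned_vertex u : path_spanned (e u).
Proof.
exists (fun v => (u == v)%:R), (fun=> 0); rewrite /vertex_arrow_comb.
rewrite (bigD1 u) //= eqxx scale1r !big1 ?addr0 // => [a _|v vu].
  by rewrite scale0r.
by rewrite eq_sym (negPf vu) scale0r.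
Qed.

Lemma path_spanned_arrow a : path_spanned (y a).
Proof.
exists (fun=> 0), (fun b => (a == b)%:R); rewrite /vertex_arrow_comb.
rewrite [X in _ + X](bigD1 a) //= eqxx scale1r !big1 ?addr0 ?add0r //.
  by move=> b ba; rewrite eq_sym (negPf ba) scale0r.
by move=> b _; rewrite scale0r.
Qed.

Lemma path_spannedP z r s :
  path_spanned r -> path_spanned s -> path_spanned (z *: r + s).
Proof.
move=> [c [d ->]] [c' [d' ->]].
exists (fun u => z * c u + c' u), (fun a => z * d a + d' a).
rewrite /vertex_arrow_comb scalerDr addrACA !scaler_sumr -!big_split.
by congr (_ + _); apply: eq_bigr => i _ /=; rewrite scalerDl scalerA.
Qed.

Lemma path_spanned0 : path_spanned 0.
Proof.
exists (fun=> 0), (fun=> 0); rewrite /vertex_arrow_comb !big1 ?addr0 // => i _;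
  by rewrite scale0r.
Qed.

Lemma path_spannedZ z r : path_spanned r -> path_spanned (z *: r).
Proof.
by move=> rS; rewrite -[z *: r]addr0; apply: path_spannedP path_spanned0.
Qed.

Lemma path_spannedD r s :
  path_spanned r -> path_spanned s -> path_spanned (r + s).
Proof. by move=> rS sS; rewrite -[r]scale1r; apply: path_spannedP. Qed.

Lemma path_spanned_sum (I : finType) (F : I -> R) :
  (forall i, path_spanned (F i)) -> path_spanned (\sum_i F i).
Proof.
move=> FS; apply: big_ind => // [|r s]; first exact: path_spanned0.
exact: path_spannedD.
Qed.

Hypothesis sys : path_system.

Lemma vertex_arrow u a : e u * y a = if u == tgt a then y a else 0.
Proof.
by rewrite -(arrow_tgtE sys) mulrA (vertex_orth sys); case: eqP => [->|];
  rewrite ?mul0r.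
Qed.

Lemma arrow_vertex a u : y a * e u = if u == src a then y a else 0.
Proof.
rewrite -[in LHS](arrow_srcE sys) -mulrA (vertex_orth sys) eq_sym.
by case: eqP => _; rewrite ?mulr0 ?(arrow_srcE sys).
Qed.

(** Multiplying by vertices on both sides isolates one coefficient, because no
    two arrows, and no arrow and trivial path, share both endpoints. *)
Lemma path_free_simple :
    (forall u, e u != 0) -> (forall a, y a != 0) ->
    (forall a : arrow Q, src a != tgt a) ->
    (forall a b : arrow Q, src a = src b -> tgt a = tgt b -> a = b) ->
  path_free.
Proof.
move=> e0 y0 noloop simple c d cd0; split=> [u|a].
  have /eqP := congr1 (fun z => e u * z * e u) cd0.
  rewrite mulr0 mul0r mulrDr mulrDl !mulr_sumr !mulr_suml (bigD1 u) //=.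
  rewrite !big1 => [|a _|v vu].
  - rewrite !addr0 -scalerAr (vertex_orth sys) eqxx -scalerAl (vertex_orth sys).
    by rewrite eqxx scaler_eq0 (negPf (e0 u)) orbF => /eqP.
  - rewrite -scalerAr vertex_arrow -scalerAl; case: eqP => [->|_]; last first.
      by rewrite mul0r scaler0.
    by rewrite arrow_vertex eq_sym (negPf (noloop a)) scaler0.
  - by rewrite -scalerAr (vertex_orth sys) eq_sym (negPf vu) scaler0 mul0r.
have /eqP := congr1 (fun z => e (tgt a) * z * e (src a)) cd0.
rewrite mulr0 mul0r mulrDr mulrDl !mulr_sumr !mulr_suml.
rewrite [X in X + _]big1 ?add0r => [|u _]; last first.
  rewrite -scalerAr (vertex_orth sys) -scalerAl; case: eqP => [<-|_].
    by rewrite (vertex_orth sys) eq_sym (negPf (noloop a)) scaler0.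
  by rewrite mul0r scaler0.
rewrite (bigD1 a) //= big1 => [|b ba].
  rewrite addr0 -scalerAr vertex_arrow eqxx -scalerAl arrow_vertex eqxx.
  by rewrite scaler_eq0 (negPf (y0 a)) orbF => /eqP.
rewrite -scalerAr vertex_arrow -scalerAl; case: eqP => [tab|_]; last first.
  by rewrite mul0r scaler0.
rewrite arrow_vertex; case: eqP => [sab|_]; last by rewrite scaler0.
by rewrite (simple a b sab tab) eqxx in ba.
Qed.

(** The image of a path in [R] has to vanish from length two on, as products of
    arrows do. *)
Definition path_eval (p : qpath Q) : R :=
  match (val p).2 with [::] => e (psrc p) | [:: a] => y a | _ => 0 end.

Definition arrow_path (a : arrow Q) : qpath Q :=
  @QPath Q (src a, [:: a]) (introT andP (conj (eqxx (src a)) isT)).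

Lemma vertex_path_eval p : e (ptgt p) * path_eval p = path_eval p.
Proof.
rewrite /path_eval /ptgt; case: (val p).2 => [|a [|b s]] /=.
- by rewrite (vertex_orth sys) eqxx.
- exact: arrow_tgtE.
- exact: mulr0.
Qed.

Lemma path_eval_vertex p : path_eval p * e (psrc p) = path_eval p.
Proof.
have := qpath_walk p; rewrite /path_eval -/(psrc p).
rewrite -[qpath_val p]/(val p); case: (val p).2 => [|a [|b s]] /=.
- by rewrite (vertex_orth sys) eqxx.
- by rewrite andbT => /eqP <-; apply: arrow_srcE.
- by rewrite mul0r.
Qed.

Lemma path_evalM q p :
  mlift path_eval (of_opath k (Defs.pcomp q p)) = path_eval q * path_eval p.
Proof.
case: pcompP => [r pq rs rt rE|npq] /=; last first.
  rewrite linear0 -(path_eval_vertex q) -(vertex_path_eval p) mulrA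
    -(mulrA _ (e _) (e _)).
  by rewrite (vertex_orth sys) eq_sym (negPf npq) mulr0 mul0r.
rewrite mliftU; case pE: (val p).2 (rE) => [|a s] /=.
  move=> rq; have tp : ptgt p = psrc p by rewrite /ptgt pE.
  have -> : r = q by apply: qpath_eq; rewrite // rs -pq tp.
  have -> : path_eval p = e (psrc p) by rewrite /path_eval pE.
  by rewrite -tp pq path_eval_vertex.
case qE: (val q).2 => [|b t] /=.
  rewrite cats0 => rp; have -> : r = p by apply: qpath_eq; rewrite // rp pE.
  have -> : path_eval q = e (psrc q) by rewrite /path_eval qE.
  by rewrite -pq vertex_path_eval.
move=> rE'; rewrite /path_eval rE' qE pE.
by case: t s {qE pE rE' rE} => [|? ?] [|? ?];
  rewrite /= ?(arrow_mul0 sys) ?mulr0 ?mul0r.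
Qed.

(** Bilinearity reduces multiplicativity to paths, that is to [path_evalM]. *)
Lemma mlift_path_eval_morph :
  monoid_morphism (mlift path_eval : path_algebra k Q -> R).
Proof.
pose L : path_algebra k Q -> R := mlift path_eval.
rewrite -[mlift path_eval : path_algebra k Q -> R]/L.
have LU p : L (of_path k p) = path_eval p by exact: mliftU.
have LZ a g : L (a *: g) = a *: L g by exact: linearZ.
have Lsum I (s : seq I) F : L (\sum_(i <- s) F i) = \sum_(i <- s) L (F i).
  exact: linear_sum.
have LM q p : L (pmul (of_path k q) (of_path k p)) = L (of_path k q) * L
  (of_path k p).
  by have := path_evalM q p; rewrite -pmulU -(LU q) -(LU p).
have L1 : L 1 = 1.
  rewrite -[1]/(pone k Q) Lsum -(vertex_sum1 sys); apply: eq_bigr => u _.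
  exact: LU.
have LZU a p : L (a *: of_path k p) = a *: L (of_path k p) by exact: LZ.
have LZl a p h : L (pmul (a *: of_path k p) h) = a *: L (pmul (of_path k p) h).
  by rewrite pmulZl; exact: LZ.
have LZr a p h : L (pmul h (a *: of_path k p)) = a *: L (pmul h (of_path k p)).
  by rewrite pmulZr; exact: LZ.
split=> // g h; move: L {LU L1 LZ} LZU LZl LZr Lsum LM => L LZU LZl LZr Lsum LM.
rewrite -[g * h]/(pmul g h) [g]path_algebraE pmul_suml !Lsum mulr_suml.
apply: eq_bigr => q _; rewrite LZl LZU -scalerAl; congr (_ *: _).
rewrite [h]path_algebraE pmul_sumr !Lsum mulr_sumr.
apply: eq_bigr => p _; rewrite LZr LZU -scalerAr; congr (_ *: _).
exact: LM.
Qed.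

Lemma mlift_path_evalE (g : path_algebra k Q) :
  mlift path_eval g =
  vertex_arrow_comb (fun u => (g : {malg k[qpath Q]})@_(triv u))
                    (fun a => (g : {malg k[qpath Q]})@_(arrow_path a)).
Proof.
pose T (g : path_algebra k Q) : R := vertex_arrow_comb
  (fun u => (g : {malg k[qpath Q]})@_(triv u))
  (fun a => (g : {malg k[qpath Q]})@_(arrow_path a)).
have T_lin : linear T.
  move=> z g1 g2; rewrite /T /vertex_arrow_comb scalerDr addrACA !scaler_sumr
    -!big_split.
  by congr (_ + _); apply: eq_bigr => i _ /=;
    rewrite mcoeffD mcoeffZ scalerDl scalerA.
pose F := GRing.isLinear.Build k (path_algebra k Q) R _ T T_lin.
pose TL : {linear path_algebra k Q -> R} := HB.pack T F.
rewrite -[RHS]/(TL g) [g]path_algebraE !linear_sum; apply: eq_bigr => p _.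
rewrite !linearZ /= mliftU; congr (_ *: _).
rewrite /T /vertex_arrow_comb /path_eval.
have := qpath_walk p; rewrite -/(psrc p) -[qpath_val p]/(val p).
case pE: (val p).2 => [|a [|b s]] /= wp.
- have -> : p = triv (psrc p) by apply: qpath_eq.
  rewrite (bigD1 (psrc p)) //= mcoeffUU scale1r !big1 ?addr0 // => [a _|u up].
    by rewrite mcoeffU; case: eqP => [/(congr1 (fun p => (val p).2))|_];
      rewrite // scale0r.
  rewrite mcoeffU; case: eqP => [/(congr1 (@psrc _))|_];
    last by rewrite scale0r.
  by rewrite /psrc /= => uE; rewrite -uE eqxx in up.
- have -> : p = arrow_path a.
    by apply: qpath_eq => //; rewrite /psrc /=; case/andP: wp => /eqP.
  rewrite [X in _ + X](bigD1 a) //= mcoeffUU scale1r !big1 ?addr0 ?add0r //.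
    move=> b ba; rewrite mcoeffU; case: eqP => [|_]; last by rewrite scale0r.
    by move/(congr1 (fun p => (val p).2)) => -[abE]; rewrite abE eqxx in ba.
  by move=> u _; rewrite mcoeffU;
    case: eqP => [/(congr1 (fun p => (val p).2))|_]; rewrite // scale0r.
- rewrite !big1 ?addr0 // => i _; rewrite mcoeffU.
    by case: eqP => [/(congr1 (fun p => (val p).2))|_];
      rewrite /= ?pE // scale0r.
  by case: eqP => [/(congr1 (fun p => (val p).2))|_]; rewrite /= ?pE // scale0r.
Qed.

(** The kernel of the evaluation of paths consists of the combinations of long
    paths, because the coefficients on paths of length at most one are the
    coordinates of the image in a basis. *)
Theorem path_system_iso :
  path_free -> (forall r, path_spanned r) ->
  alg_isomorphic R (path_algebra_lt2 k Q).
Proof.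
move=> e_free e_span.
pose F := GRing.isMonoidMorphism.Build (path_algebra k Q) R
  (mlift path_eval) mlift_path_eval_morph.
pose L := GRing.isLinear.Build k (path_algebra k Q) R _
  (mlift path_eval) (mlift_linear path_eval).
pose H : {lrmorphism path_algebra k Q -> R} :=
  HB.pack (mlift path_eval : path_algebra k Q -> R) L F.
have HE g : H g = mlift path_eval g by [].
have HB x z : H (x - z) = H x - H z by exact: raddfB.
have HM x z : H (x * z) = H x * H z by exact: rmorphM.
apply: (first_isomorphism (h := H)) => [r|g].
  have [c [d ->]] := e_span r.
  exists (\sum_u c u *: of_path k (triv u) + \sum_a d a *: of_path k
    (arrow_path a)).
  rewrite HE linearD !linear_sum; congr (_ + _); apply: eq_bigr => i _;
  by rewrite linearZ /= mliftU.
split=> [|Hg0].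
  move=> gI; apply: (gI (fun a => H a = 0)); last first.
    move=> _ [p lp ->]; rewrite HE mliftU /path_eval.
    by move: lp; rewrite /plen; case: (val p).2 => [|a [|b s]].
  split=> [|x z|a x|a x]; first exact: raddf0.
  - by move=> Hx Hz; rewrite HB Hx Hz subrr.
  - by move=> Hx; rewrite HM Hx mulr0.
  - by move=> Hx; rewrite HM Hx mul0r.
move: Hg0; rewrite HE mlift_path_evalE => /e_free[c0 d0].
rewrite [g]path_algebraE; apply: big_ind => [|x z|p _]; first exact: ideal0.
  exact: idealD.
have [lp|lp] := leqP (plen p) 1; last first.
  by apply: (idealZ (I := long_ideal k Q)); apply: mem_ideal_gen; exists p.
suff -> : g@_p = 0 by rewrite scale0r; apply: ideal0.
have := qpath_walk p; move: lp; rewrite /plen -/(psrc p) -[qpath_val p]/(val p).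
case pE: (val p).2 => [|a [|b s]] //= _ wp.
  by rewrite -(c0 (psrc p)); congr mcoeff; apply: qpath_eq.
rewrite -(d0 a); congr mcoeff; apply: qpath_eq => //.
by rewrite /psrc /=; case/andP: wp => /eqP.
Qed.

End PathSystem.

(** * The twisted tensor product by generators and relations *)

(** The algebra [k^n (x) k[x]/(p)], described by [e_i = e_i (x) 1] and
    [x = 1 (x) x]. As soon as there are several vertices or a root of [p], the
    classification depends on the twisting map only through these identities. *)
Record colored_presentation (k : fieldType) (n : nat) (alpha beta : k)
    (phi : 'I_n -> 'I_n) (col : 'I_n -> k) (R : algType k)
    (e : 'I_n -> R) (x : R) : Prop := ColoredPresentation {
  cp_orth : forall i j, e i * e j = if i == j then e i else 0;
  cp_sum1 : \sum_i e i = 1;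
  cp_quad : x * x = alpha *: x - beta *: 1;
  cp_comm : forall i,
    x * e i = \sum_(j | phi j == i) (col j *: e j + e j * x) - col i *: e i;
  cp_free : forall c d : 'I_n -> k,
    \sum_i (c i *: e i + d i *: (e i * x)) = 0 ->
    (forall i, c i = 0) /\ (forall i, d i = 0);
  cp_span : forall r, exists c d : 'I_n -> k,
    r = \sum_i (c i *: e i + d i *: (e i * x))
}.

Section Qpoly.
Variables (k : fieldType) (alpha beta : k).
Notation p := (poly_p alpha beta).
Notation B := {poly %/ p}.

Lemma size_poly_p : size p = 3.
Proof.
rewrite /poly_p -addrA size_polyDl size_polyXn //.
rewrite (leq_ltn_trans (size_polyD _ _)) // gtn_max size_polyN.
rewrite (leq_ltn_trans (size_scale_leq _ _)) ?size_polyX //=.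
by rewrite (leq_ltn_trans (size_polyC_leq1 _)).
Qed.

Lemma monic_poly_p : p \is monic.
Proof. by rewrite -mk_monic_poly_p monic_mk_monic. Qed.

Lemma qX_comb_val c d :
  val (c *: 1 + d *: 'qX : B) = c *: 1 + d *: 'X :> {poly k}.
Proof.
transitivity (c *: 1 + d *: polyn ('qX : B) : {poly k}); first by [].
by rewrite qpolyXE ?size_poly_p ?monic_poly_p.
Qed.

Lemma qX_quad : 'qX * 'qX = alpha *: 'qX - beta *: 1 :> B.
Proof.
have -> : alpha *: 'qX - beta *: 1 = in_qpoly p (alpha *: 'X - beta *: 1).
  rewrite -['qX]/(in_qpoly p 'X) -!in_qpolyZ.
  by rewrite -scaleN1r -[- (beta *: 1)]scaleN1r in_qpolyD !in_qpolyZ in_qpoly1.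
rewrite -['qX]/(in_qpoly p 'X) -in_qpolyM.
have -> : 'X * 'X = p + (alpha *: 'X - beta *: 1).
  by rewrite /poly_p alg_polyC -expr2; ring.
rewrite in_qpolyD; suff -> : in_qpoly p p = 0 by rewrite add0r.
apply/val_inj; rewrite /= mk_monic_poly_p.
exact: (Pdiv.RingMonic.rmodpp monic_poly_p).
Qed.

Lemma qX_free c d : c *: 1 + d *: 'qX = 0 :> B -> c = 0 /\ d = 0.
Proof.
move/(congr1 val); rewrite qX_comb_val => cd0.
have E i : (c *: 1 + d *: 'X : {poly k})`_i = 0.
  by have := congr1 (fun q : {poly k} => q`_i) cd0; rewrite coef0.
split; [have := E 0 | have := E 1]; rewrite coefD !coefZ coefX coef1 /=.
  by rewrite mulr1 mulr0 addr0.
by rewrite mulr0 mulr1 add0r.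
Qed.

Lemma qX_span (b : B) : exists c d, b = c *: 1 + d *: 'qX.
Proof.
exists (val b)`_0, (val b)`_1; apply/val_inj; rewrite qX_comb_val.
apply/polyP => -[|[|i]]; rewrite coefD !coefZ coefX coef1 /=.
- by rewrite mulr1 mulr0 addr0.
- by rewrite mulr0 mulr1 add0r.
- rewrite !mulr0 addr0 nth_default //.
  have sp : size (mk_monic p) = 3 by rewrite mk_monic_poly_p size_poly_p.
  have sb : (size (val b) < 3)%N.
    by rewrite -[X in (_ < X)%N]sp; apply: size_mk_monic.
  move: sb; rewrite ltnS => sb; exact: (leq_trans sb).
Qed.

End Qpoly.

Section TwistedPresentation.
Variables (k : fieldType) (alpha beta : k) (n : nat).
Variable tau : twistingMap (kpow k n.+1) {poly %/ poly_p alpha beta}.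
Variables (f delta : kpow k n.+1 -> kpow k n.+1).
Variables (phi : 'I_n.+1 -> 'I_n.+1) (col : 'I_n.+1 -> k).
Hypothesis Hpair : twisting_pair tau f delta.
Hypothesis Hmap : induced_map f phi.
Hypothesis Hcol : coloration delta phi col.

Notation A := (kpow k n.+1).
Notation B := {poly %/ poly_p alpha beta}.
Notation T := (twisted_tensor tau).

(** Contracting the first factor with the [i]-th coordinate of [k^n] reads off
    the coefficients of [e_i (x) 1] and [e_i (x) x]. *)
Definition coord_slice (i : 'I_n.+1) : tensor A B -> B :=
  tlift (fun (a : A) (b : B) => (a i : k) *: b).

HB.instance Definition _ i := GRing.Linear.on (coord_slice i).

Lemma coord_sliceE i (a : A) (b : B) :
  coord_slice i (tens a b) = (a i : k) *: b.
Proof.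
rewrite /coord_slice tlift_tens // => [u c x y|v c x y].
  by rewrite scalerDr !scalerA mulrC.
by rewrite !ffunE scalerDl scalerA.
Qed.

Lemma kbaseE (a : A) : a = \sum_i (a i : k) *: kbase k i.
Proof.
apply/ffunP => j; rewrite sum_ffunE (bigD1 j) //= !ffunE eqxx big1
  ?addr0 => [|i ij].
  by rewrite [_ *: _]mulr1.
by rewrite !ffunE eq_sym (negPf ij) [_ *: _]mulr0.
Qed.

Lemma tens_mul1 (a a' : A) (b : B) :
  (tens a 1 : T) * (tens a' b : T) = (tens (a * a') b : T).
Proof. by rewrite [LHS]twmul_pure twist_1l lrmulE mul1r. Qed.

Lemma twisted_presentation :
  colored_presentation alpha beta phi col (R := T)
    (fun i => tens (kbase k i) 1) (tens 1 'qX).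
Proof.
pose e i : T := tens (kbase k i) 1; pose x : T := tens 1 'qX.
have ex i : e i * x = tens (kbase k i) 'qX by rewrite [LHS]tens_mul1 mulr1.
split=> [i j||||c d cd0|r].
- rewrite [LHS]tens_mul1; case: eqP => [<-|/eqP ij].
    congr tens; apply/ffunP => u; rewrite !ffunE.
    by case: (u == i); rewrite ?mulr1 ?mulr0.
  rewrite -[RHS](tens0l (V := B) A 1); congr tens; apply/ffunP => u;
    rewrite !ffunE.
  by case: eqP => [->|_]; rewrite ?mul0r // (negPf ij) mulr0.
- rewrite -[LHS](tens_suml _ (fun i => kbase k i)); congr tens.
  rewrite [RHS]kbaseE; apply: eq_bigr => i _; by rewrite ffunE scale1r.
- rewrite [LHS]twmul_pure twist_1r lrmulE mul1r qX_quad tensDr.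
  by rewrite -scaleNr !tensZr scaleNr.
- move=> i; rewrite [LHS]twmul_pure Hpair linearD /= !lrmulE !mul1r !mulr1.
  have tsum (F : 'I_n.+1 -> A) (b : B) :
      tens (\sum_(j | phi j == i) F j) b = \sum_(j | phi j == i) tens (F j) b.
    rewrite big_mkcond tens_suml [RHS]big_mkcond; apply: eq_bigr => j _.
    by case: ifP; rewrite ?tens0l.
  have [_ ->] := Hcol; rewrite Hmap -scaleNr tensDl !tsum tensZl scaleNr.
  rewrite addrAC -big_split /=; congr (_ - _); apply: eq_bigr => j _.
  by rewrite tensZl -[tens (kbase k j) 'qX]ex.
- have E i : c i *: 1 + d i *: 'qX = 0 :> B.
    have := congr1 (coord_slice i) cd0;
      rewrite linear0 linear_sum (bigD1 i) //=.
    rewrite big1 ?addr0 => [|j ji];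
      rewrite linearD !linearZ /= -/(e _) -/x ex !coord_sliceE !ffunE.
      by rewrite eqxx !scale1r.
    by rewrite eq_sym (negPf ji) !scale0r !scaler0 addr0.
  by split=> i; have [] := qX_free (E i).
have [s ->] := tensor_sum r.
have [cd cdE] : exists cd : A * B -> k * k,
    forall p, p.2 = (cd p).1 *: 1 + (cd p).2 *: 'qX.
  have h (p : A * B) : exists cd : k * k, p.2 = cd.1 *: 1 + cd.2 *: 'qX.
    by have [c [d ->]] := qX_span p.2; exists (c, d).
  by exists (fun p => sval (cid (h p))) => p; case: (cid _).
exists (fun i => \sum_(p <- s) (cd p).1 * p.1 i),
  (fun i => \sum_(p <- s) (cd p).2 * p.1 i).
under [RHS]eq_bigr => i _ do rewrite !scaler_suml -big_split.
rewrite exchange_big; apply: eq_bigr => p _ /=.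
rewrite cdE tensDr !tensZr [in LHS](kbaseE p.1) !tens_suml !scaler_sumr
  -big_split.
by apply: eq_bigr => i _ /=; rewrite -/(e i) -/x ex !tensZl !scalerA.
Qed.

(** [k^1] is the base field, so [b |-> 1 (x) b] is onto. *)
Lemma twisted_one_vertex : n = 0 -> alg_isomorphic T B.
Proof.
move=> n0; pose h (b : B) : T := tens 1 b.
have h_lin : linear h by move=> c u v; rewrite /h tensDr tensZr.
have h_mul : monoid_morphism h.
  by split=> // u v; rewrite [RHS]twmul_pure twist_1r lrmulE mul1r.
pose hL := GRing.isLinear.Build k B T _ h h_lin.
pose hM := GRing.isMonoidMorphism.Build B T h h_mul.
pose H : {lrmorphism B -> T} := HB.pack h hL hM.
apply: (@alg_isomorphic_of_inverse k T B H (coord_slice ord0)) => [r|b].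
  have [s ->] := tensor_sum r; rewrite !linear_sum; apply: eq_bigr => p _ /=.
  rewrite coord_sliceE /h tensZr -tensZl; congr tens; apply/ffunP => i.
  have -> : i = ord0 by apply/val_inj; case: i => i /=; rewrite n0; case: i.
  by rewrite !ffunE [_ *: _]mulr1.
by rewrite /= coord_sliceE ffunE scale1r.
Qed.

End TwistedPresentation.

(** * Cycles of a self-map with connected graph *)

Section ConnectedMap.
Variables (n : nat) (phi : 'I_n.+1 -> 'I_n.+1).
Hypothesis conn : connected_quiver (map_quiver phi).

Lemma connected_invariant (D : pred 'I_n.+1) :
  (forall v, D (phi v) = D v) -> forall u v, D u = D v.
Proof.
move=> Dphi u v; apply: (@closed_connect _ _ D _ u v (conn u v)) => z w /=.
rewrite !unfold_in; case/orP=> /existsP[a /andP[/eqP <- /eqP <-]] /=.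
  by rewrite Dphi.
by rewrite Dphi.
Qed.

(** Reaching [l] by iterating [phi] is invariant under [phi] and its inverse
    images, so every vertex reaches [l] by connectedness; but the orbit of a
    vertex on a 2-cycle stays on that cycle. *)
Lemma loop_no_other_2cycle l i : phi l = l -> phi (phi i) = i -> i = l.
Proof.
move=> ll ii; pose D v := `[< exists m, iter m phi v = l >].
have Dphi v : D (phi v) = D v.
  apply/asboolP/asboolP => [[m]|[[|m]]]; first by rewrite -iterSr; exists m.+1.
    by move=> /= ->; exists 0.
  by rewrite iterSr; exists m.
have /asboolP[m im] : D i by rewrite (connected_invariant Dphi i l);
  apply/asboolP; exists 0.
have [mi|mi] : iter m phi i = i \/ iter m phi i = phi i.
- by elim: m {im} => [|m [IH|IH]] /=;
  [left|rewrite IH; right|rewrite IH ii; left].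
- by rewrite -mi.
- by rewrite -ii -mi im.
Qed.

(** Otherwise the 2-cycle would be closed under [phi] and under inverse images,
    hence exhaust a connected quiver. *)
Lemma incoming_at_2cycle i :
    phi i != i -> phi (phi i) = i -> ~ is_strict_cycle 2 phi ->
  exists2 j, phi (phi j) != j & phi j = i \/ phi j = phi i.
Proof.
move=> ni ii nstrict; pose D v := (v == i) || (v == phi i).
have [j /andP[Dj nDj]|noj] := pickP (fun j => D (phi j) && ~~ D j).
  exists j; last by case/orP: Dj => /eqP; [left|right].
  apply: contra nDj => /eqP jj; case/orP: Dj => /eqP pj; rewrite /D -jj pj.
    by rewrite eqxx orbT.
  by rewrite ii eqxx.
case: nstrict; exists [:: i; phi i]; split=> // [|j].
  by rewrite /ucycle /= /frel /= ii !eqxx inE eq_sym ni.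
have Dphi v : D (phi v) = D v.
  apply/idP/idP => [Dv|]; first by have := noj v; rewrite Dv => /negbFE.
  by case/orP => /eqP ->; rewrite /D ?ii eqxx ?orbT.
by rewrite !inE -/(D j) (connected_invariant Dphi j i) /D eqxx.
Qed.

End ConnectedMap.

Lemma root_poly_pE (k : fieldType) (alpha beta z : k) :
  root (poly_p alpha beta) z = (z ^+ 2 - alpha * z + beta == 0).
Proof. by rewrite /root /poly_p !hornerE. Qed.

Lemma root_poly_qE (k : fieldType) (alpha beta z : k) :
  root (poly_q alpha beta) z = (z ^+ 2 + alpha * z + beta == 0).
Proof. by rewrite /root /poly_q !hornerE. Qed.

(** Replacing two vectors by formal coordinates turns an identity between their
    linear combinations into two scalar identities, which [ring] decides. *)
Lemma plane_coordinates (k : fieldType) (V : lmodType k) (u v : V) :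
  exists L : k -> k -> V, [/\ u = L 1 0, v = L 0 1,
    forall a b c d, L a b + L c d = L (a + c) (b + d),
    forall z a b, z *: L a b = L (z * a) (z * b) &
    forall a b, - L a b = L (- a) (- b)].
Proof.
exists (fun a b => a *: u + b *: v); split=> [||a b c d|z a b|a b].
- by rewrite scale1r scale0r addr0.
- by rewrite scale1r scale0r add0r.
- by rewrite addrACA !scalerDl.
- by rewrite scalerDr !scalerA.
- by rewrite opprD !scaleNr.
Qed.

(** * Arrows of the opposite quiver inside the algebra *)

Section Presented.
Variables (k : fieldType) (alpha beta : k) (n : nat).
Variables (phi : 'I_n.+1 -> 'I_n.+1) (col : 'I_n.+1 -> k).
Variables (R : algType k) (e : 'I_n.+1 -> R) (x : R).
Hypothesis pres : colored_presentation alpha beta phi col e x.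

Definition qval z : k := z ^+ 2 + alpha * z + beta.

Definition peirce_arrow i : R := e i * x + col i *: e i.
Notation Y := peirce_arrow.

Let orth := cp_orth pres.

Lemma vertex_peirce_arrow j i : e j * Y i = if j == i then Y i else 0.
Proof.
rewrite mulrDr mulrA -scalerAr !orth.
by case: eqP => [->|_]; rewrite ?mul0r ?scaler0 ?addr0.
Qed.

(** In [e_i x e_j] the relation for [x e_j] leaves [-a_j e_j] when [i = j];
    adding [a_i e_i] to [e_i x] is what cancels this term, and so moves the
    arrow into a single Peirce component. *)
Lemma peirce_arrow_vertex i j : Y i * e j = if phi i == j then Y i else 0.
Proof.
rewrite mulrDl -mulrA (cp_comm pres) mulrBr mulr_sumr.
have col_orth : e i * (col j *: e j) = (col i *: e i) * e j.
  by rewrite -scalerAr -scalerAl orth; case: eqP => [->|]; rewrite ?scaler0.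
rewrite col_orth subrK.
have term u : e i * (col u *: e u + e u * x) = if u == i then Y i else 0.
  rewrite mulrDr -scalerAr mulrA orth eq_sym addrC.
  by case: eqP => [->|_]; rewrite ?mul0r ?scaler0 ?addr0.
under eq_bigr => u _ do rewrite term.
rewrite big_mkcond (bigD1 i) //= eqxx big1 ?addr0 // => u ui.
by rewrite (negPf ui); case: ifP.
Qed.

Lemma peirce_arrow_mul i j : Y i * Y j =
  if phi i == j then (alpha + col i + col j) *: Y i - qval (col i) *: e i
  else 0.
Proof.
rewrite {2}/peirce_arrow mulrDr mulrA -scalerAr peirce_arrow_vertex.
case: ifP => _; last by rewrite mul0r scaler0 addr0.
rewrite /peirce_arrow mulrDl -mulrA (cp_quad pres) mulrBr -!scalerAr mulr1
  -scalerAl.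
rewrite /qval; move: (e i) (e i * x) => E X.
have [L [-> -> LD LZ LN]] := plane_coordinates E X.
by rewrite !(LZ, LN, LD); congr L; ring.
Qed.

Lemma cp_free2 i c d : c *: e i + d *: Y i = 0 -> c = 0 /\ d = 0.
Proof.
move=> cd0; pose c' j := if j == i then c + d * col i else 0.
pose d' j := if j == i then d else 0.
have [|cz dz] := cp_free pres (c := c') (d := d').
  rewrite (bigD1 i) //= big1 => [|j /negPf ji]; last first.
    by rewrite /c' /d' ji !scale0r addr0.
  by rewrite /c' /d' eqxx addr0 -[RHS]cd0 scalerDr scalerDl scalerA addrAC
    addrA.
have := dz i; have := cz i; rewrite /c' /d' eqxx => + d0.
by rewrite d0 mul0r addr0.
Qed.

Lemma vertex_neq0 i : e i != 0.
Proof.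
apply: contra_neq (oner_neq0 k) => e0.
by have [] := @cp_free2 i 1 0 _; rewrite // e0 scaler0 scale0r addr0.
Qed.

Lemma peirce_arrow_neq0 i : Y i != 0.
Proof.
apply: contra_neq (oner_neq0 k) => Y0.
by have [] := @cp_free2 i 0 1 _; rewrite // Y0 scaler0 scale0r addr0.
Qed.

(** Right multiplication by [e_(phi (phi i))] fixes [y_i y_(phi i)], but it
    kills [y_i] or [e_i] unless they end at that vertex. *)
Lemma peirce_arrow_two_step i :
  (phi (phi i) != phi i -> alpha + col i + col (phi i) = 0) /\
  (phi (phi i) != i -> qval (col i) = 0).
Proof.
set s := _ + _ + _; have YYE : Y i * Y (phi i) = s *: Y i - qval (col i) *: e i.
  by rewrite peirce_arrow_mul eqxx.
have : Y i * Y (phi i) * e (phi (phi i)) = Y i * Y (phi i).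
  by rewrite -mulrA peirce_arrow_vertex eqxx.
rewrite YYE mulrBl -!scalerAl peirce_arrow_vertex orth.
rewrite eq_sym (eq_sym i); case: eqP => _; case: eqP => _ //=.
- move=> /esym/eqP; rewrite scaler0 subr0 -subr_eq0 addrAC subrr add0r
  oppr_eq0 => /eqP qe.
  have [|q0 _] := @cp_free2 i (qval (col i)) 0;
    first by rewrite qe scale0r addr0.
  by split.
- move=> /esym/eqP; rewrite scaler0 sub0r -subr_eq0 opprK subrK => /eqP sY.
  have [|_ s0] := @cp_free2 i 0 s; first by rewrite sY scale0r addr0.
  by split.
- rewrite !scaler0 subr0 => /esym; rewrite addrC -scaleNr => /cp_free2[q0 s0].
  by split=> // _; apply/eqP; rewrite -oppr_eq0 q0.
Qed.

Lemma path_spanned_all (Q : quiver) (e' : vertex Q -> R) (y' : arrow Q -> R) :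
  (forall i, path_spanned e' y' (e i)) ->
  (forall i, path_spanned e' y' (Y i)) ->
  forall r, path_spanned e' y' r.
Proof.
move=> eS YS r; have [c [d ->]] := cp_span pres r.
apply: path_spanned_sum => i; apply: path_spannedP => //; apply: path_spannedZ.
have -> : e i * x = - col i *: e i + Y i by rewrite scaleNr addrCA addNr addr0.
exact: path_spannedP.
Qed.

(** At a loop vertex the arrow can be shifted by any multiple of the idempotent
    without leaving its Peirce component; this freedom makes a loop nilpotent
    when [p] has a double root. *)
Definition shifted_arrow (t : 'I_n.+1 -> k) i : R := e i * x + t i *: e i.
Notation Z := shifted_arrow.

Theorem nilpotent_iso (t : 'I_n.+1 -> k) :
    (forall i, phi i != i -> t i = col i) ->
    (forall i, Z t i * Z t (phi i) = 0) ->
  alg_isomorphic R (path_algebra_lt2 k (quiver_op (map_quiver phi))).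
Proof.
move=> t_col Z0.
have ZE i : Z t i = Y i + (t i - col i) *: e i.
  by rewrite /shifted_arrow /peirce_arrow scalerBl -addrA [_ + (_ - _)]addrC
    subrK.
have eZ j i : e j * Z t i = if j == i then Z t i else 0.
  rewrite ZE mulrDr vertex_peirce_arrow -scalerAr orth.
  by case: eqP => [->|_]; rewrite ?scaler0 ?addr0.
have Ze i j : Z t i * e j = if phi i == j then Z t i else 0.
  rewrite ZE mulrDl peirce_arrow_vertex -scalerAl orth.
  have [ii|ii] := eqVneq (phi i) i;
    last by rewrite t_col // subrr !scale0r !addr0.
  by rewrite ii; case: eqP => [->|_]; rewrite ?scaler0 ?addr0.
have sys : @path_system k (quiver_op (map_quiver phi)) R e (Z t).
  split=> [||i|i|i j]; [exact: orth|exact: cp_sum1 pres| | |].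
  - by rewrite /= eZ eqxx.
  - by rewrite /= Ze eqxx.
  - have := eZ j j; rewrite eqxx => <-; rewrite mulrA Ze.
    by case: eqP => [<-|_]; rewrite ?Z0 ?mul0r.
apply: (path_system_iso sys) => [c d cd0|].
  have [|cz dz] := cp_free pres (c := fun i => c i + d i * t i) (d := d).
    rewrite -[RHS]cd0 /vertex_arrow_comb -big_split; apply: eq_bigr => i _ /=.
    by rewrite scalerDr scalerDl scalerA addrAC addrA.
  by split=> // i; have := cz i; rewrite dz mul0r addr0.
apply: path_spanned_all => i;
  first exact: (@path_spanned_vertex k (quiver_op (map_quiver phi)) R e (Z t)
    i).
have -> : Y i = (col i - t i) *: e i + Z t i.
  by rewrite ZE addrCA -scalerDl addrA subrK subrr scale0r addr0.
apply: path_spannedP; first exact: (@path_spanned_vertex k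
  (quiver_op (map_quiver phi)) R e (Z t) i).
exact: (@path_spanned_arrow k (quiver_op (map_quiver phi)) R e (Z t) i).
Qed.

End Presented.

(** * The cases of the classification *)

Section PresentedCases.
Variables (k : fieldType) (alpha beta : k) (n : nat).
Variables (phi : 'I_n.+1 -> 'I_n.+1) (col : 'I_n.+1 -> k).
Variables (R : algType k) (e : 'I_n.+1 -> R) (x : R).
Hypothesis pres : colored_presentation alpha beta phi col e x.

Notation Y := (peirce_arrow col e x).
Notation qval := (qval alpha beta).
Let orth := cp_orth pres.
Let two_step := peirce_arrow_two_step pres.

(** Without loops, [a_(phi j) = -alpha - a_j], and [z |-> -alpha - z] preserves
    [q]. So a vertex that enters a 2-cycle from outside, whose color is a root
    of [q], transmits this property to the cycle. *)
Lemma no_loop_color_root : connected_quiver (map_quiver phi) ->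
  (forall i, phi i != i) -> ~ is_strict_cycle 2 phi ->
  forall i, qval (col i) = 0.
Proof.
move=> conn noloop nstrict i.
have opposite j : qval (col (phi j)) = qval (col j).
  have /eqP := (two_step j).1 (noloop (phi j)).
  rewrite addrC addr_eq0 => /eqP ->; rewrite /qval; ring.
have [ii|ii] := eqVneq (phi (phi i)) i; last exact: (two_step i).2 ii.
have [j jj pj] := incoming_at_2cycle conn (noloop i) ii nstrict.
have := opposite j; rewrite ((two_step j).2 jj).
by case: pj => ->; rewrite ?opposite.
Qed.

Lemma no_loop_iso : connected_quiver (map_quiver phi) ->
  (forall i, phi i != i) -> ~ is_strict_cycle 2 phi ->
  alg_isomorphic R (path_algebra_lt2 k (quiver_op (map_quiver phi))).
Proof.
move=> conn noloop nstrict; apply: (nilpotent_iso pres (t := col)) => // i.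
rewrite [LHS](peirce_arrow_mul pres) eqxx no_loop_color_root //.
by rewrite ((two_step i).1 (noloop _)) !scale0r subrr.
Qed.

Section TwoCycle.
Variables u v : 'I_n.+1.
Hypotheses (phi_u : phi u = v) (phi_v : phi v = u) (uv : u != v).
Hypothesis all_uv : forall i, i = u \/ i = v.

Let phiK : involutive phi.
Proof. by move=> i; case: (all_uv i) => ->; rewrite !(phi_u, phi_v). Qed.

Let noloop i : phi i != i.
Proof. by case: (all_uv i) => ->; rewrite ?phi_u ?phi_v // eq_sym. Qed.

Let two_cycle_mul i : Y i * Y (phi i) = - qval (col i) *: e i.
Proof.
rewrite (peirce_arrow_mul pres) eqxx ((two_step i).1 (noloop _)).
by rewrite scale0r sub0r scaleNr.
Qed.

(** Exchanging the two vertices identifies the quiver with its opposite, hence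
    the arrow [i] is represented by [y_(phi i)]. *)
Lemma strict_2cycle_nilpotent_iso : (forall i, qval (col i) = 0) ->
  alg_isomorphic R (path_algebra_lt2 k (map_quiver phi)).
Proof.
move=> q0; pose y i := Y (phi i).
have sys : @path_system k (map_quiver phi) R e y.
  split=> [||i|i|i j]; [exact: orth|exact: cp_sum1 pres| | |].
  - by rewrite /= (vertex_peirce_arrow pres) eqxx.
  - by rewrite /= (peirce_arrow_vertex pres) phiK eqxx.
  - rewrite /y; have [<-|ij] := eqVneq (phi (phi i)) (phi j); last first.
      by rewrite (peirce_arrow_mul pres) (negPf ij).
    by rewrite two_cycle_mul q0 oppr0 scale0r.
apply: (path_system_iso sys) => [|].
  apply: (path_free_simple sys) => /= [i|i|i|i j ->//].
  - exact: vertex_neq0 pres i.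
  - exact: peirce_arrow_neq0 pres _.
  - by rewrite eq_sym.
apply: (path_spanned_all pres) => i;
  first exact: (@path_spanned_vertex k (map_quiver phi) R e y i).
by rewrite -[i]phiK; exact: (@path_spanned_arrow k (map_quiver phi) R e y
  (phi i)).
Qed.

(** The products [y_u y_v = c e_u] and [y_v y_u = c e_v] involve the same [c],
    because the colors are exchanged by [z |-> -alpha - z]. So [y_u] and
    [c^-1 y_v] are the off-diagonal matrix units. *)
Lemma strict_2cycle_matrix_iso : ~ (forall i, qval (col i) = 0) ->
  alg_isomorphic R 'M[k]_2.
Proof.
move=> nq; pose c := - qval (col u).
have qv : qval (col v) = qval (col u).
  have /eqP := (two_step u).1 (noloop _).
  rewrite phi_u addrC addr_eq0 => /eqP ->; rewrite /qval; ring.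
have c0 : c != 0.
  rewrite oppr_eq0; apply/eqP => q0; apply: nq => i.
  by case: (all_uv i) => ->; rewrite ?qv.
have YuYv : Y u * Y v = c *: e u by have := two_cycle_mul u; rewrite phi_u.
have YvYu : Y v * Y u = c *: e v by have := two_cycle_mul v; rewrite phi_v qv.
have YuYu : Y u * Y u = 0 by rewrite (peirce_arrow_mul pres) phi_u eq_sym
  (negPf uv).
have YvYv : Y v * Y v = 0 by rewrite (peirce_arrow_mul pres) phi_v (negPf uv).
have eY i j := vertex_peirce_arrow pres i j.
have Ye i j := peirce_arrow_vertex pres i j.
pose G (i j : 'I_2) : R :=
  if i == ord0 then if j == ord0 then e u else Y u
  else if j == ord0 then c^-1 *: Y v else e v.
have ord2 (i : 'I_2) : i = ord0 \/ i = ord_max.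
  by case: i => [[|[|//]]] ?; [left|right]; apply/val_inj.
have sum2 (F : 'I_2 -> R) : \sum_i F i = F ord0 + F ord_max.
  by rewrite big_ord_recl big_ord1; congr (_ + F _); apply/val_inj.
have sum_uv (F : 'I_n.+1 -> R) : \sum_i F i = F u + F v.
  rewrite (bigD1 u) //= (bigD1 v) /= 1?eq_sym // big1 ?addr0 // => i
    /andP[iu iv].
  by case: (all_uv i) => ii; rewrite ii eqxx in iu iv.
apply: (matrix_units_iso (G := G)) => [i j a b||r].
- case: (ord2 i) => ->; case: (ord2 j) => ->;
  case: (ord2 a) => ->; case: (ord2 b) => ->;
  rewrite /G /= -?scalerAl -?scalerAr ?scalerA ?orth ?eY ?Ye ?phi_u ?phi_v
    ?YuYv ?YvYu ?YuYu ?YvYv;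
  rewrite ?eqxx ?(negPf uv) ?[v == u]eq_sym ?(negPf uv) ?scaler0 ?scalerA
    ?mulVf ?mulfV ?scale1r //.
- by rewrite sum2 /G /= -(cp_sum1 pres) sum_uv.
have [c' [d ->]] := cp_span pres r; rewrite sum_uv.
exists (\matrix_(i, j)
  if i == ord0 then if j == ord0 then c' u - d u * col u else d u
  else if j == ord0 then d v * c else c' v - d v * col v).
rewrite !sum2 !mxE /G /= scalerA -mulrA mulfV // mulr1.
congr (_ + _); rewrite /peirce_arrow.
  move: (e u) (e u * x) => E F;
    have [L [-> -> LD LZ _]] := plane_coordinates E F.
  by rewrite !(LZ, LD); congr L; ring.
move: (e v) (e v * x) => E F; have [L [-> -> LD LZ _]] := plane_coordinates E F.
by rewrite !(LZ, LD); congr L; ring.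
Qed.

End TwoCycle.

Section OneCycle.
Variable l : 'I_n.+1.
Hypotheses (phi_l : phi l = l) (col_l : col l = 0).
Hypothesis no_2cycle : forall i, phi (phi i) = i -> i = l.

Let loop_l i : phi i = i -> i = l.
Proof. by move=> ii; apply: no_2cycle; rewrite !ii. Qed.

Lemma one_cycle_color_root i : i != l -> qval (col i) = 0.
Proof.
by move=> il; apply: (two_step i).2; apply: contra_neq il; apply: no_2cycle.
Qed.

(** Away from the loop, an arrow has nonzero products only with the loop, and is
    then an eigenvector for it. *)
Lemma one_cycle_mul i j : i != l -> Y i * Y j =
  if (phi i == l) && (j == l) then (alpha + col i) *: Y i else 0.
Proof.
move=> il; rewrite (peirce_arrow_mul pres) one_cycle_color_root // scale0r
  subr0.
have [ij|ij] := eqVneq (phi i) j; last first.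
  by case: eqP => [il'|] //=; rewrite -il' eq_sym (negPf ij).
rewrite -ij andbb; have [->|pl] := eqVneq (phi i) l;
  first by rewrite col_l addr0.
by rewrite (two_step i).1 ?scale0r //; apply: contra_neq pl; apply: loop_l.
Qed.

Lemma loop_arrow_mul s t :
  (Y l + s *: e l) * (Y l + t *: e l) =
  (alpha + s + t) *: Y l + (s * t - beta) *: e l.
Proof.
have expand (a b c d : R) : (a + b) * (c + d) = a * c + b * c + (a * d + b * d).
  by rewrite mulrDr !mulrDl.
rewrite expand -!scalerAl -!scalerAr (peirce_arrow_mul pres).
rewrite (peirce_arrow_vertex pres) (vertex_peirce_arrow pres) orth phi_l !eqxx
  col_l.
move: (e l) (Y l) => E F; have [L [-> -> LD LZ LN]] := plane_coordinates E F.
by rewrite /qval !(LZ, LN, LD); congr L; ring.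
Qed.

(** As [p = (x - rho)^2], the loop [y_l - rho e_l] squares to zero; it also
    kills the arrows from [l], whose eigenvalue under [y_l] is a root of [p]. *)
Lemma one_cycle_double_root_iso rho :
    (forall z, root (poly_p alpha beta) z -> z = rho) ->
    root (poly_p alpha beta) rho ->
  alg_isomorphic R (path_algebra_lt2 k (quiver_op (map_quiver phi))).
Proof.
move=> rho_uniq; rewrite root_poly_pE => /eqP rho_root.
(* The sum of the roots of [p] is [alpha], so [alpha - rho] is also a root. *)
have alphaE : alpha = rho + rho.
  apply/eqP; rewrite -subr_eq; apply/eqP/rho_uniq; rewrite root_poly_pE.
  by apply/eqP; rewrite -[RHS]rho_root; ring.
pose t i := if i == l then - rho else col i.
have Zl : shifted_arrow e x t l = Y l + (- rho) *: e l.
  by rewrite /shifted_arrow /t eqxx /peirce_arrow col_l scale0r addr0.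
have Zi i : i != l -> shifted_arrow e x t i = Y i.
  by move=> il; rewrite /shifted_arrow /t (negPf il).
apply: (nilpotent_iso pres (t := t)) => i; first by rewrite /t;
  have [->|//] := eqVneq i l; rewrite phi_l eqxx.
have [->|il] := eqVneq i l.
  rewrite phi_l Zl loop_arrow_mul.
  have -> : alpha + - rho + - rho = 0 by rewrite alphaE; ring.
  have -> : - rho * - rho - beta = 0.
    transitivity (- (rho ^+ 2 - alpha * rho + beta));
      last by rewrite rho_root oppr0.
    by rewrite alphaE; ring.
  by rewrite !scale0r addr0.
rewrite Zi //; have [pl|pl] := eqVneq (phi i) l; last first.
  by rewrite Zi // one_cycle_mul // (negPf pl) andbF.
rewrite pl Zl mulrDr -scalerAr one_cycle_mul // pl eqxx
  (peirce_arrow_vertex pres) pl eqxx.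
rewrite -scalerDl /=; suff -> : alpha + col i = rho by rewrite subrr scale0r.
apply: rho_uniq; rewrite root_poly_pE; apply/eqP.
by rewrite -[RHS](one_cycle_color_root il) /qval; ring.
Qed.

Section DistinctRoots.
Variables r1 r2 : k.
Hypotheses (r12 : r1 != r2) (root_r1 : root (poly_q alpha beta) r1)
  (root_r2 : root (poly_q alpha beta) r2).

Let sum_roots : alpha = - (r1 + r2).
Proof.
move: root_r1 root_r2; rewrite !root_poly_qE => /eqP q1 /eqP q2.
have /eqP : (r1 - r2) * (r1 + r2 + alpha) = 0.
  by rewrite -[RHS](subrr 0) -{1}q1 -q2; ring.
rewrite mulf_eq0 subr_eq0 (negPf r12) addrC addr_eq0 => /eqP //.
Qed.

Let prod_roots : beta = r1 * r2.
Proof.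
move: root_r1; rewrite root_poly_qE sum_roots => /eqP q1.
by apply/eqP; rewrite -subr_eq0 -q1; apply/eqP; ring.
Qed.

Let color_cases i : i != l -> col i = r1 \/ col i = r2.
Proof.
move/one_cycle_color_root; rewrite /qval sum_roots prod_roots => q0.
have /eqP : (col i - r1) * (col i - r2) = 0 by rewrite -[RHS]q0; ring.
by rewrite mulf_eq0 !subr_eq0 => /orP[] /eqP; [left|right].
Qed.

Let rr (m : 'I_2) := if m == ord0 then r1 else r2.
Let rr' (m : 'I_2) := if m == ord0 then r2 else r1.

Let rr_neq m : rr m - rr' m != 0.
Proof. by rewrite subr_eq0 /rr /rr'; case: ifP => _; rewrite // eq_sym. Qed.

(** The loop [y_l] has the roots [-r1] and [-r2] of [p] as eigenvalues; these
    are its spectral idempotents in [e_l R e_l]. The one for the color [r1]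
    belongs to the eigenvalue [-r2 = alpha + r1]. *)
Definition split_loop (m : 'I_2) : R :=
  (rr m - rr' m)^-1 *: (Y l + rr m *: e l).
Notation eps := split_loop.

Let ord2 (i : 'I_2) : i = ord0 \/ i = ord_max.
Proof. by case: i => [[|[|//]]] ?; [left|right]; apply/val_inj. Qed.

Lemma split_loop_orth m m' : eps m * eps m' = if m == m' then eps m else 0.
Proof.
rewrite /eps -scalerAl -scalerAr scalerA loop_arrow_mul.
have [<-|mm] := eqVneq m m'.
  have -> : alpha + rr m + rr m = rr m - rr' m.
    by rewrite sum_roots /rr /rr'; case: ifP => _; ring.
  have -> : rr m * rr m - beta = (rr m - rr' m) * rr m.
    by rewrite prod_roots /rr /rr'; case: ifP => _; ring.
  by rewrite -[(_ * rr m) *: _]scalerA -scalerDr scalerA mulfVK // rr_neq.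
have -> : alpha + rr m + rr m' = 0.
  by move: mm; rewrite sum_roots /rr; case: (ord2 m) => ->;
    case: (ord2 m') => -> //= _; ring.
have -> : rr m * rr m' - beta = 0.
  by move: mm; rewrite prod_roots /rr; case: (ord2 m) => ->;
    case: (ord2 m') => -> //= _; ring.
by rewrite !scale0r addr0 scaler0.
Qed.

Lemma split_loop_sum : eps ord0 + eps ord_max = e l.
Proof.
rewrite /eps /rr /rr' /=; move: (e l) (Y l) => E F.
have [L [-> -> LD LZ LN]] := plane_coordinates E F.
rewrite !(LZ, LD); congr L; field; rewrite ?subr_eq0 ?r12 1?eq_sym ?r12 //.
Qed.

Lemma loop_arrow_split : Y l = (- r2) *: eps ord0 + (- r1) *: eps ord_max.
Proof.
rewrite /eps /rr /rr' /=; move: (e l) (Y l) => E F.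
have [L [-> -> LD LZ LN]] := plane_coordinates E F.
rewrite !(LZ, LD); congr L; field; rewrite ?subr_eq0 ?r12 1?eq_sym ?r12 //.
Qed.

Lemma split_loop_neq0 m : eps m != 0.
Proof.
apply: contra_neq (rr_neq m) => /eqP; rewrite scaler_eq0 => /orP[|/eqP eps0].
  by rewrite invr_eq0 => /eqP.
have [|_ /eqP] := cp_free2 pres (i := l) (c := rr m) (d := 1).
  by rewrite scale1r addrC.
by rewrite oner_eq0.
Qed.

Lemma vertex_split_loop i m : e i * eps m = if i == l then eps m else 0.
Proof.
rewrite -scalerAr mulrDr (vertex_peirce_arrow pres) -scalerAr orth.
by case: eqP => [->|]; rewrite ?scaler0 ?addr0 ?scaler0.
Qed.

Lemma split_loop_vertex i m : eps m * e i = if i == l then eps m else 0.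
Proof.
rewrite -scalerAl mulrDl (peirce_arrow_vertex pres) -scalerAl orth phi_l eq_sym.
by case: eqP => _; rewrite ?scaler0 ?addr0 ?scaler0.
Qed.

(** The eigenvalue [alpha + a_i] of [y_i] under [y_l] is the one of the
    idempotent indexed by the color [a_i]. *)
Lemma arrow_split_loop i m : i != l -> phi i = l -> col i = rr m ->
  Y i * eps m = Y i.
Proof.
move=> il pl cm; rewrite -scalerAr mulrDr -scalerAr one_cycle_mul //.
rewrite (peirce_arrow_vertex pres) pl eqxx /= -scalerDl scalerA.
suff -> : alpha + col i + rr m = rr m - rr' m by rewrite mulVf ?rr_neq ?scale1r.
by rewrite cm sum_roots /rr /rr'; case: ifP => _; ring.
Qed.

Notation Qh := (quiver_op (hat_quiver phi col r1 r2)).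

Definition hat_vertex_elt (u : vertex Qh) : R :=
  match u with inl i => e (val i) | inr m => eps m end.

Definition hat_arrow_elt (a : arrow Qh) : R :=
  match (val a).1 with inl i => Y (val i) | inr _ => 0 end.

Let nonloop (i : {i | phi i != i}) : val i != l.
Proof. by apply: contraNneq (valP i) => ->; rewrite phi_l. Qed.

Lemma hat_system : path_system hat_vertex_elt hat_arrow_elt.
Proof.
split=> [[i|m] [j|m']||[[[i|m] v] /= uv]|[[[i|m] [j|m']] /= uv]|].
- exact: orth.
- by rewrite /= vertex_split_loop (negPf (nonloop i)).
- by rewrite /= split_loop_vertex (negPf (nonloop j)).
- exact: split_loop_orth.
- rewrite big_sumType /= big_ord_recl big_ord1 -(cp_sum1 pres) [RHS](bigD1 l)
  //= addrC.
  have -> : lift ord0 ord0 = ord_max :> 'I_2 by apply/val_inj.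
  rewrite split_loop_sum; congr (_ + _).
  rewrite -(big_sub_cond (fun i => phi i != i) predT e); apply: eq_bigl => i.
  rewrite andbT unfold_in; apply/idP/idP; first by apply: contra_neq => ->.
  by apply: contra_neq; apply: loop_l.
- by rewrite /hat_arrow_elt /= (vertex_peirce_arrow pres) eqxx.
- by [].
- by rewrite /hat_arrow_elt /= (peirce_arrow_vertex pres) uv.
- rewrite /hat_arrow_elt /=; case/andP: uv => /eqP/loop_l pl /eqP cm.
  exact: arrow_split_loop (nonloop i) pl cm.
- by [].
- by [].
- move=> [[[i|m] v] uv] [[[j|m'] w] vw];
  rewrite /hat_arrow_elt /= ?mulr0 ?mul0r //.
  by rewrite one_cycle_mul ?nonloop // (negPf (nonloop j)) andbF.
Qed.

(** The modified quiver has neither loops nor parallel arrows, so linear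
    independence is automatic and it remains to recover [e_l] and [y_l] from the
    two spectral idempotents. *)
Lemma one_cycle_distinct_roots_iso :
  alg_isomorphic R (path_algebra_lt2 k Qh).
Proof.
apply: (path_system_iso hat_system).
  apply: (path_free_simple hat_system) => [[i|m]|[[[i|m] v] uv]|[[[i|m] [j|m']]
    uv]|a b sab tab] //=.
  - exact: vertex_neq0 pres _.
  - exact: split_loop_neq0.
  - exact: peirce_arrow_neq0 pres _.
  - rewrite eq_sym; apply: contraTneq uv => -[->] /=; exact: (valP j).
  - by apply: val_inj; apply: injective_projections.
have epsS m : path_spanned hat_vertex_elt hat_arrow_elt (eps m).
  exact: (@path_spanned_vertex k Qh R hat_vertex_elt hat_arrow_elt (inr m)).
apply: (path_spanned_all pres) => i; have [->|il] := eqVneq i l.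
- by rewrite -split_loop_sum; apply: path_spannedD.
- have ni : phi i != i by apply: contra_neq il; apply: loop_l.
  exact: (@path_spanned_vertex k Qh R hat_vertex_elt hat_arrow_elt
    (inl (exist _ i ni))).
- by rewrite loop_arrow_split; apply: path_spannedP => //; apply: path_spannedZ.
have ni : phi i != i by apply: contra_neq il; apply: loop_l.
have arrowS (v : hat_vertex phi) :
      hat_arrow col r1 r2 (inl (exist _ i ni)) v ->
    path_spanned hat_vertex_elt hat_arrow_elt (Y i).
  move=> uv; exact: (@path_spanned_arrow k Qh R hat_vertex_elt hat_arrow_elt
    (exist _ (inl (exist _ i ni), v) uv)).
have [pl|pl] := eqVneq (phi i) l; last first.
  have nj : phi (phi i) != phi i by apply: contra_neq pl; apply: loop_l.
  by apply: (arrowS (inl (exist _ (phi i) nj))) => /=.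
have [m cm] : exists m, col i = rr m.
  by case: (color_cases il) => ->; [exists ord0|exists ord_max].
by apply: (arrowS (inr m)); rewrite /= pl phi_l eqxx /=; apply/eqP.
Qed.

End DistinctRoots.
End OneCycle.
End PresentedCases.

Theorem theorem2p8 (k : fieldType) (alpha beta : k) (n : nat)
    (tau : twistingMap (kpow k n.+1) {poly %/ poly_p alpha beta})
    (f delta : kpow k n.+1 -> kpow k n.+1)
    (phi : 'I_n.+1 -> 'I_n.+1) (col : 'I_n.+1 -> k)
    (Hpair : twisting_pair tau f delta)
    (Hmap : induced_map f phi)
    (Hcol : coloration delta phi col)
    (Hconn : connected_quiver (map_quiver phi)) :
  let R := twisted_tensor tau : algType k in
  let p := poly_p alpha beta in
  let q := poly_q alpha beta in
  let Q := map_quiver phi in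
  [/\ is_strict_cycle 2 phi ->
        ((forall i, root q (col i)) ->
           alg_isomorphic R (path_algebra_lt2 k Q)) /\
        (~ (forall i, root q (col i)) ->
           alg_isomorphic R 'M[k]_2),
      is_cycle 1 phi ->
        [/\ (forall x, ~~ root p x) ->
              n.+1 = 1%N /\ alg_isomorphic R {poly %/ p},
            (exists! r, root p r) ->
              alg_isomorphic R (path_algebra_lt2 k (quiver_op Q)) &
            (exists s1 s2, [/\ s1 != s2, root p s1 & root p s2]) ->
            forall r1 r2, r1 != r2 -> root q r1 -> root q r2 ->
              alg_isomorphic R
                (path_algebra_lt2 k (quiver_op (hat_quiver phi col r1 r2)))] &
      ~ is_strict_cycle 2 phi -> ~ is_cycle 1 phi ->
        alg_isomorphic R (path_algebra_lt2 k (quiver_op Q))].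
Proof.
have pres := twisted_presentation Hpair Hmap Hcol.
move=> R p q Q.
have root_col i : root q (col i) <-> qval alpha beta (col i) = 0.
  by rewrite root_poly_qE; split=> /eqP.
split.
- move=> [[|u [|v [|w c]]] [szc ucyc all_c]] //; move: ucyc.
  rewrite /ucycle /= /frel /= inE !andbT => /andP[/andP[/eqP uv /eqP vu] nuv].
  have all_uv i : i = u \/ i = v.
    by have := all_c i; rewrite !inE => /orP[] /eqP; [left|right].
  split=> [rootc|nrootc].
    by apply: (strict_2cycle_nilpotent_iso pres uv vu) => // i; apply/root_col.
  apply: (strict_2cycle_matrix_iso pres uv vu) => // q0.
  by apply: nrootc => i; apply/root_col.
- move=> [[|l [|w c]] [szc ucyc]] //; move: ucyc;
  rewrite /ucycle /= /frel /= !andbT => /eqP ll.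
  have col_l : col l = 0 by apply: Hcol.1.
  have no2 i : phi (phi i) = i -> i = l by exact: loop_no_other_2cycle.
  split.
  + move=> noroot; have all_l i : i = l.
      apply/eqP/negPn/negP => /(one_cycle_color_root pres no2) q0.
      have /negP[] := noroot (- col i); rewrite root_poly_pE -q0 /qval.
      by apply/eqP; ring.
    have n0 : n = 0 by have /(congr1 val) := etrans (all_l ord_max)
      (esym (all_l ord0)).
    by split; [rewrite n0|apply: twisted_one_vertex].
  + move=> [rho [rho_root rho_uniq]].
    by apply: (one_cycle_double_root_iso pres ll col_l no2 _ rho_root) => z
      /rho_uniq.
  + by move=> _ r1 r2; apply: (one_cycle_distinct_roots_iso pres ll).
move=> nstrict nloop; apply: (no_loop_iso pres) => // i.
apply/eqP => ii; apply: nloop; exists [:: i]; split=> //.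
by rewrite /ucycle /= /frel /= ii eqxx.
Qed.
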